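(* Let $Z$ be a complete metric space and let $M$ be a self-similar, doubling, bi-Lipschitz homogeneous metric space (e.g. $M=\mathbb{R}^n$). Suppose $X_0,X_1,\dots,X_k\subset Z$ are closed subsets such that each $X_i$ admits a bi-Lipschitz embedding $\phi_i$ into $M$ and $\phi_0(X_0)$ has nonempty interior. Then $\mathcal{F}\left(\bigcup_{i=0}^k X_i\right)\approx\mathcal{F}(M)$.
   Context: For a metric space $(X,d)$ with a fixed basepoint $x_0$, $\mathrm{Lip}_0(X)$ is the Banach space of all Lipschitz functions $f:X\to\mathbb{R}$ with $f(x_0)=0$, normed by $\|f\|=\sup_{u\neq v}|f(u)-f(v)|/d(u,v)$. The Lipschitz free space $\mathcal{F}(X)$ is the closed linear span in $\mathrm{Lip}_0(X)^*$ of the evaluations $\delta_x$, $\delta_x(f)=f(x)$, $x\in X$ (up to isometric isomorphism it does not depend on the basepoint). The symbol $\approx$ means linearly isomorphic as Banach spaces. A metric space $M$ with basepoint $x_0$ is self-similar if there exist a constant $R>1$ and a bijection $f:M\to M$ with $d(f(x),f(y))=R\,d(x,y)$ for all $x,y\in M$ and $f(x_0)=x_0$. It is bi-Lipschitz homogeneous if for every $x,y\in M$ there is a bi-Lipschitz homeomorphism $f:M\to M$ with $f(x)=y$. It is doubling if for some $D$ every ball of radius $r$ in $M$ can be covered by at most $D$ balls of radius $r/2$.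
   Formalization: M is additionally assumed to have more than one point; for a one-point M the claim fails, since with X_0, X_1 distinct singletons the free space of the union is one-dimensional while F(M)=0. *)

(* Defs.v *)
From HB Require Import structures.
From mathcomp Require Import all_boot all_order all_algebra.
From mathcomp Require Import all_classical all_reals all_analysis.

Set Implicit Arguments.
Unset Strict Implicit.
Unset Printing Implicit Defensive.

Import Order.TTheory GRing.Theory Num.Theory.
Import numFieldNormedType.Exports.

Local Open Scope classical_set_scope.
Local Open Scope ring_scope.

(* The restricted metric on a subset [A] of a metric space; the underlying
   topology and balls are the library's initial structure on [set_type A]. *)
Section subset_metric.
Context (R : realType) (Z : metricType R) (A : set Z).

Let dist (x y : A) : R := mdist (set_val x) (set_val y).

Let dist_ge0 x y : 0 <= dist x y.
Proof. exact: mdist_ge0. Qed.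

Let dist_positivity x y : dist x y = 0 -> x = y.
Proof. by move/mdist_positivity; exact: val_inj. Qed.

Let ballE (x : A) d : ball x d = [set y | dist x y < d].
Proof.
rewrite -[ball x d]/(set_val @^-1` ball (set_val x) d) ballEmdist.
by apply/seteqP; split.
Qed.

HB.instance Definition _ :=
  @PseudoMetric_isMetric.Build R (set_type A) dist dist_ge0 dist_positivity
    ballE.

End subset_metric.

Section metric_notions.
Context (R : realType).

(* The axiom of the library's [completeType], which would also impose a choice
   of default point. *)
Definition complete_metric (Z : metricType R) : Prop :=
  forall F : set_system Z, ProperFilter F -> cauchy F ->
    exists z : Z, F --> z.

Definition bilipschitz (X Y : metricType R) (f : X -> Y) : Prop :=
  exists c C : R, [/\ 0 < c, 0 < C & forall x y,
    c * mdist x y <= mdist (f x) (f y) <= C * mdist x y].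

Definition self_similar (M : metricType R) (x0 : M) : Prop :=
  exists (a : R) (f : M -> M),
    [/\ 1 < a, bijective f,
        forall x y, mdist (f x) (f y) = a * mdist x y & f x0 = x0].

Definition bilipschitz_homogeneous (M : metricType R) : Prop :=
  forall x y : M, exists f : M -> M,
    [/\ bijective f, bilipschitz f & f x = y].

Definition doubling (M : metricType R) : Prop :=
  exists D : nat, forall (x : M) (r : R), 0 < r ->
    exists2 s : seq M, (size s <= D)%N &
      ball x r `<=` \bigcup_(c in [set` s]) ball c (r / 2).

End metric_notions.

Section lip0.
Context (R : realType) (M : metricType R) (x0 : M).

Definition is_lip (f : M -> R^o) : Prop :=
  exists L : R, forall u v, `|f u - f v| <= L * mdist u v.

Definition lip0_pred : {pred M -> R^o} :=
  [pred f | `[< is_lip f /\ f x0 = 0 >]].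

Record lip0 := Lip0 { lip0_fun :> M -> R^o; lip0P : lip0_fun \in lip0_pred }.

HB.instance Definition _ := [isSub for lip0_fun].
HB.instance Definition _ := [Choice of lip0 by <:].

Let lip0_submod : submod_closed lip0_pred.
Proof.
split.
  by apply/asboolP; split => //; exists 0 => u v; rewrite mul0r subrr normr0.
move=> a f g /asboolP[[L Lf] f0] /asboolP[[K Kg] g0]; apply/asboolP; split.
  exists (`|a| * L + K) => u v.
  have -> : (a *: f + g) u - (a *: f + g) v = a * (f u - f v) + (g u - g v).
    by rewrite !fctE/= mulrBr opprD addrACA.
  rewrite (le_trans (ler_normD _ _))// normrM mulrDl -mulrA lerD//.
  by rewrite ler_wpM2l.
by rewrite !fctE/= f0 g0 scaler0 addr0.
Qed.

HB.instance Definition _ :=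
  GRing.isSubmodClosed.Build R (M -> R^o) lip0_pred lip0_submod.
HB.instance Definition _ := [SubChoice_isSubLmodule of lip0 by <:].

Let slopes (f : M -> R^o) : set R :=
  [set `|f uv.1 - f uv.2| / mdist uv.1 uv.2 | uv in [set uv | uv.1 != uv.2]].

Definition lip_norm (f : lip0) : R := sup (slopes f).

Let slopes_ub (f : lip0) : has_ubound (slopes f).
Proof.
have /asboolP[[L Lf] _] := lip0P f; exists L => _ [[u v]/= uv <-].
by rewrite ler_pdivrMr ?mdist_gt0.
Qed.

Lemma lip_norm_ge0 f : 0 <= lip_norm f.
Proof.
rewrite /lip_norm; have [->|/set0P[x Sx]] := eqVneq (slopes f) set0.
  by rewrite sup0.
apply: le_trans (ub_le_sup (slopes_ub f) Sx).
by case: Sx => -[u v]/= _ <-; rewrite divr_ge0 ?mdist_ge0.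
Qed.

Lemma lip_normP (f : lip0) u v : `|f u - f v| <= lip_norm f * mdist u v.
Proof.
have [->|uv] := eqVneq u v; first by rewrite subrr normr0 mdistxx mulr0.
rewrite -ler_pdivrMr ?mdist_gt0//.
by apply: (ub_le_sup (slopes_ub f)); exists (u, v).
Qed.

Lemma lip_norm_le (f : lip0) (L : R) : 0 <= L ->
  (forall u v, `|f u - f v| <= L * mdist u v) -> lip_norm f <= L.
Proof.
move=> L0 fL; rewrite /lip_norm.
have [->|/set0P S0] := eqVneq (slopes f) set0; first by rewrite sup0.
apply: ge_sup => // _ [[u v]/= uv <-].
by rewrite ler_pdivrMr ?mdist_gt0.
Qed.

Let lip_normD f g : lip_norm (f + g) <= lip_norm f + lip_norm g.
Proof.
apply: lip_norm_le => [|u v]; first by rewrite addr_ge0 ?lip_norm_ge0.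
have -> : (f + g) u - (f + g) v = (f u - f v) + (g u - g v).
  by rewrite /= opprD addrACA.
by rewrite (le_trans (ler_normD _ _))// mulrDl lerD ?lip_normP.
Qed.

Let lip_normZ_le (a : R) f : lip_norm (a *: f) <= `|a| * lip_norm f.
Proof.
apply: lip_norm_le => [|u v]; first by rewrite mulr_ge0 ?lip_norm_ge0.
have -> : (a *: f) u - (a *: f) v = a * (f u - f v) by rewrite /= mulrBr.
by rewrite normrM -mulrA ler_wpM2l ?lip_normP.
Qed.

Let lip_normZ (a : R) f : lip_norm (a *: f) = `|a| * lip_norm f.
Proof.
apply/eqP; rewrite eq_le lip_normZ_le/=.
have [->|a0] := eqVneq a 0; first by rewrite normr0 mul0r lip_norm_ge0.
rewrite -ler_pdivlMl ?normr_gt0// -normfV.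
by apply: le_trans (lip_normZ_le _ _); rewrite scalerA mulVf// scale1r.
Qed.

Let lip_norm_eq0 f : lip_norm f = 0 -> f = 0.
Proof.
move=> f0; apply/val_inj/funext => x /=.
have /asboolP[_ fx0] := lip0P f.
have := lip_normP f x x0; rewrite f0 mul0r fx0 subr0 normr_le0.
by move/eqP.
Qed.

HB.instance Definition _ :=
  Lmodule_isNormed.Build R lip0 lip_normD lip_normZ lip_norm_eq0.

End lip0.

Section dual.
Context (R : realType) (V : normedModType R).

Definition dual_pred : {pred V -> R^o} :=
  [pred f | `[< linear f /\ continuous f >]].

Record dual :=
  Dual { dual_fun :> V -> R^o; dualP : dual_fun \in dual_pred }.

HB.instance Definition _ := [isSub for dual_fun].
HB.instance Definition _ := [Choice of dual by <:].

Let dual_submod : submod_closed dual_pred.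
Proof.
split.
  apply/asboolP; split; last exact: cst_continuous.
  by move=> a u v; rewrite -[RHS]/(a *: 0 + 0) scaler0 addr0.
move=> a f g /asboolP[lf cf] /asboolP[lg cg]; apply/asboolP; split.
  move=> b u v; rewrite !fctE/= lf lg !scalerDr addrACA !scalerA.
  by rewrite [a * b]mulrC.
by move=> x; apply: cvgD; [apply: cvgZr; exact: cf | exact: cg].
Qed.

HB.instance Definition _ :=
  GRing.isSubmodClosed.Build R (V -> R^o) dual_pred dual_submod.
HB.instance Definition _ := [SubChoice_isSubLmodule of dual by <:].

Let dual_linear (f : dual) : linear f.
Proof. by have /asboolP[] := dualP f. Qed.

HB.instance Definition _ (f : dual) :=
  GRing.isLinear.Build R V R^o *:%R f (dual_linear f).

Lemma dual_continuous (f : dual) : continuous f.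
Proof. by have /asboolP[] := dualP f. Qed.

Let values (f : dual) : set R := [set `|f v| | v in [set v | `|v| <= 1]].

Definition dual_norm (f : dual) : R := sup (values f).

Let values_neq0 f : values f !=set0.
Proof. by exists 0, 0; rewrite /= ?normr0 ?ler01// linear0 normr0. Qed.

Let values_ub f : has_ubound (values f).
Proof.
have /linear_boundedP := @continuous_linear_bounded _ _ _ 0 _ (@dual_continuous f 0).
move=> /pinfty_ex_gt0[M /= M0 fM]; exists M => _ [v/= v1 <-].
by rewrite (le_trans (fM v))// ler_piMr// ltW.
Qed.

Lemma dual_norm_ge0 f : 0 <= dual_norm f.
Proof.
have [x Sx] := values_neq0 f.
by apply: le_trans (ub_le_sup (values_ub f) Sx); case: Sx => v _ <-.
Qed.

Lemma dual_normP (f : dual) v : `|f v| <= dual_norm f * `|v|.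
Proof.
have [->|v0] := eqVneq v 0; first by rewrite linear0 !normr0 mulr0.
rewrite -ler_pdivrMr ?normr_gt0//.
apply: (ub_le_sup (values_ub f)); exists (`|v|^-1 *: v) => /=.
  by rewrite normrZ normfV normr_id mulVf ?normr_eq0.
by rewrite linearZ/= normrM normfV normr_id mulrC.
Qed.

Lemma dual_norm_le (f : dual) (L : R) : 0 <= L ->
  (forall v, `|f v| <= L * `|v|) -> dual_norm f <= L.
Proof.
move=> L0 fL; apply: ge_sup => // _ [v/= v1 <-].
by rewrite (le_trans (fL v))// ler_piMr.
Qed.

Let dual_normD f g : dual_norm (f + g) <= dual_norm f + dual_norm g.
Proof.
apply: dual_norm_le => [|v]; first by rewrite addr_ge0 ?dual_norm_ge0.
by rewrite (le_trans (ler_normD _ _))// mulrDl lerD ?dual_normP.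
Qed.

Let dual_normZ_le (a : R) f : dual_norm (a *: f) <= `|a| * dual_norm f.
Proof.
apply: dual_norm_le => [|v]; first by rewrite mulr_ge0 ?dual_norm_ge0.
by rewrite /= normrM -mulrA ler_wpM2l ?dual_normP.
Qed.

Let dual_normZ (a : R) f : dual_norm (a *: f) = `|a| * dual_norm f.
Proof.
apply/eqP; rewrite eq_le dual_normZ_le/=.
have [->|a0] := eqVneq a 0; first by rewrite normr0 mul0r dual_norm_ge0.
rewrite -ler_pdivlMl ?normr_gt0// -normfV.
by apply: le_trans (dual_normZ_le _ _); rewrite scalerA mulVf// scale1r.
Qed.

Let dual_norm_eq0 f : dual_norm f = 0 -> f = 0.
Proof.
move=> f0; apply/val_inj/funext => x /=.
by have := dual_normP f x; rewrite f0 mul0r normr_le0 => /eqP.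
Qed.

HB.instance Definition _ :=
  Lmodule_isNormed.Build R dual dual_normD dual_normZ dual_norm_eq0.

End dual.

Section closed_span.
Context (R : realType) (V : normedModType R) (S : set V).

Definition linear_span : set V :=
  [set v | exists (n : nat) (a : 'I_n -> R) (s : 'I_n -> V),
    (forall i, S (s i)) /\ v = \sum_(i < n) a i *: s i].

Definition closed_span_pred : {pred V} :=
  [pred v | `[< closure linear_span v >]].

Record closed_span :=
  ClosedSpan { closed_span_val :> V;
               closed_spanP : closed_span_val \in closed_span_pred }.

HB.instance Definition _ := [isSub for closed_span_val].
HB.instance Definition _ := [Choice of closed_span by <:].

Let linear_span_submod a u v :
  linear_span u -> linear_span v -> linear_span (a *: u + v).
Proof.
move=> [n [b [s [Ss ->]]]] [m [c [t [St ->]]]].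
exists (n + m)%N,
  (fun i : 'I_(n + m) => match fintype.split i with inl j => a * b j | inr j => c j end),
  (fun i : 'I_(n + m) => match fintype.split i with inl j => s j | inr j => t j end).
split=> [i|]; first by case: (fintype.split i).
rewrite big_split_ord/= scaler_sumr; congr (_ + _); apply: eq_bigr => i _.
  by rewrite scalerA (unsplitK (inl i)).
by rewrite (unsplitK (inr i)).
Qed.

Let closed_span_submod : submod_closed closed_span_pred.
Proof.
split.
  apply/asboolP/subset_closure; exists 0%N, (fun=> 0), (fun=> 0).
  by split=> [[]//|]; rewrite big_ord0.
move=> a u v /asboolP cu /asboolP cv; apply/asboolP => B nB.
have : (fun z : V * V => a *: z.1 + z.2) @ (u, v) --> a *: u + v.
  by apply: cvgD; [apply: cvgZr; exact: cvg_fst | exact: cvg_snd].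
move=> /(_ _ nB) [[P Q]/= [nP nQ] PQB].
have [p [Sp Pp]] := cu _ nP; have [q [Sq Qq]] := cv _ nQ.
exists (a *: p + q); split; first exact: linear_span_submod.
by apply: (PQB (p, q)).
Qed.

HB.instance Definition _ :=
  GRing.isSubmodClosed.Build R V closed_span_pred closed_span_submod.
HB.instance Definition _ := [SubChoice_isSubLmodule of closed_span by <:].

Let span_norm (u : closed_span) : R := `|val u|.

Let span_normD u v : span_norm (u + v) <= span_norm u + span_norm v.
Proof. exact: ler_normD. Qed.

Let span_normZ (a : R) u : span_norm (a *: u) = `|a| * span_norm u.
Proof. exact: normrZ. Qed.

Let span_norm_eq0 u : span_norm u = 0 -> u = 0.
Proof. by move/normr0_eq0 => u0; apply/val_inj. Qed.

HB.instance Definition _ :=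
  Lmodule_isNormed.Build R closed_span span_normD span_normZ span_norm_eq0.

End closed_span.

Section free_space.
Context (R : realType) (M : metricType R) (x0 : M).

Definition evaluation (x : M) : lip0 x0 -> R^o := fun f => f x.

Let evaluation_linear x : linear (evaluation x).
Proof. by []. Qed.

Let evaluationP x : evaluation x \in @dual_pred R (lip0 x0).
Proof.
apply/asboolP; split; first exact: evaluation_linear.
pose e := GRing.isLinear.Build R _ R^o *:%R _ (evaluation_linear x).
pose E : {linear lip0 x0 -> R^o} := HB.pack (evaluation x) e.
apply: (@bounded_linear_continuous _ _ _ E).
apply/linear_boundedP; exists (mdist x x0); split; first exact: num_real.
move=> r /ltW xr f; have /asboolP[_ fx0] := lip0P f.
rewrite -[E f]subr0 -fx0 (le_trans (lip_normP _ _ _))// mulrC.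
by rewrite ler_wpM2r// lip_norm_ge0.
Qed.

Definition delta (x : M) : dual (lip0 x0) := Dual (evaluationP x).

Definition free_space : normedModType R := closed_span (range delta).

End free_space.

Definition isomorphic (R : realType) (V W : normedModType R) : Prop :=
  exists (S : {linear V -> W}) (T : {linear W -> V}),
    [/\ cancel S T, cancel T S, continuous S & continuous T].

(* Main.v *)
Require Import Defs.
From HB Require Import structures.
From mathcomp Require Import all_boot all_order all_algebra.
From mathcomp Require Import all_classical all_reals all_analysis.
From mathcomp Require Import ring lra.

(* Everything is done on the spaces [Lip_0], with operators that send a
   function to finite linear combinations of its values: their adjoints carry
   free spaces to free spaces. Write [Y] for the [ell_infty] sum of countably
   many copies of [Lip_0(M)]. By Pelczynski's decomposition method it is
   enough that, for [V] either [M] or the union of the [X i], each of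
   [Lip_0(V)] and [Y] is complemented in the other.

   [Lip_0(V)] in [Y]: if [A] and [S] are closed with doubling union, a Whitney
   partition of unity off [A] recovers [f] from its restrictions to [A] and
   [S] and from the scalars [(f p - f q) / d(p, q)], where [p] is the center
   of a Whitney piece and [q] a point of [A] near it; so [Lip_0(A U S)] is
   complemented in [Lip_0(A) + Lip_0(S) + ell_infty], and, taking only the
   first summand, [Lip_0(A)] is complemented in [Lip_0(A U S)]. Each [X i] is
   complete, so its image in [M] is closed and [Lip_0(X i)] is complemented in
   [Lip_0(M)].

   [Y] in [Lip_0(V)]: cutting [M] into annuli around [x0] and rescaling them
   into a ball [B] puts [Lip_0(M)] in the [ell_infty] sum of copies of
   [Lip_0(B)]. By homogeneity a small ball at [x0] has a copy around some [y
   <> x0], whose rescalings towards [x0] are uniformly bi-Lipschitz copies in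
   separate annuli; so the [ell_infty] sum of copies of [Lip_0] of a small
   ball is complemented in [Lip_0(B)], and [V] contains a closed copy of some
   ball at [x0]. *)

Set Implicit Arguments.
Unset Strict Implicit.
Unset Printing Implicit Defensive.

Import Order.TTheory GRing.Theory Num.Theory.
Import numFieldNormedType.Exports.

Local Open Scope classical_set_scope.
Local Open Scope ring_scope.

(** * Function spaces and Pelczynski's decomposition method *)

Section finite_functionals.
Context (R : realType).

(** Required on all functions, not only on those of a given space, so that linearity comes with it:
    the operators below are bare functions, linear because each coordinate has this form. *)
Definition finite_functional (S : Type) (p : (S -> R) -> R) : Prop :=
  exists l : seq (R * S), forall f, p f = \sum_(q <- l) q.1 * f q.2.

Variable S : Type.
Implicit Types p q : (S -> R) -> R.

Lemma finite_functional_eval (s : S) : finite_functional (fun f => f s).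
Proof. by exists [:: (1, s)] => f; rewrite big_seq1 mul1r. Qed.

Lemma finite_functional0 : finite_functional (fun _ : S -> R => 0).
Proof. by exists [::] => f; rewrite big_nil. Qed.

Lemma finite_functionalD p q : finite_functional p -> finite_functional q ->
  finite_functional (fun f => p f + q f).
Proof.
by move=> [l pl] [m qm]; exists (l ++ m) => f; rewrite big_cat pl qm.
Qed.

Lemma finite_functionalZ (c : R) p : finite_functional p ->
  finite_functional (fun f => c * p f).
Proof.
move=> [l pl]; exists [seq (c * r.1, r.2) | r <- l] => f.
by rewrite big_map pl mulr_sumr; apply: eq_bigr => r _ /=; rewrite mulrA.
Qed.

Lemma finite_functionalZr (c : R) p : finite_functional p ->
  finite_functional (fun f => p f * c).
Proof.
move=> /(finite_functionalZ c) [l pl]; exists l => f.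
by rewrite mulrC pl.
Qed.

Lemma finite_functionalN p : finite_functional p ->
  finite_functional (fun f => - p f).
Proof.
move=> /(finite_functionalZ (-1)) [l pl]; exists l => f.
by rewrite -mulN1r pl.
Qed.

Lemma finite_functionalB p q : finite_functional p -> finite_functional q ->
  finite_functional (fun f => p f - q f).
Proof. by move=> hp /finite_functionalN; exact: finite_functionalD. Qed.

Lemma finite_functional_if (b : bool) p q :
  finite_functional p -> finite_functional q ->
  finite_functional (fun f => if b then p f else q f).
Proof. by case: b. Qed.

Lemma finite_functional_sum (I : Type) (r : seq I) (P : I -> (S -> R) -> R) :
  (forall i, finite_functional (P i)) ->
  finite_functional (fun f => \sum_(i <- r) P i f).
Proof.
move=> hP; elim: r => [|i r IH].
  by have [l pl] := finite_functional0; exists l => f; rewrite big_nil -pl.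
have [l pl] := finite_functionalD (hP i) IH.
by exists l => f; rewrite big_cons pl.
Qed.

Lemma finite_functional_lin p (a : R) f g : finite_functional p ->
  p (fun s => a * f s + g s) = a * p f + p g.
Proof.
move=> [l pl]; rewrite !pl mulr_sumr -big_split/=.
by apply: eq_bigr => r _; rewrite mulrDr mulrCA.
Qed.

Lemma finite_functional_add p f g : finite_functional p ->
  p (fun s => f s + g s) = p f + p g.
Proof.
move=> hp; rewrite -[p f]mul1r -finite_functional_lin//; congr p.
by apply/funext => s; rewrite mul1r.
Qed.

Lemma finite_functional_sub p f g : finite_functional p ->
  p (fun s => f s - g s) = p f - p g.
Proof.
move=> hp; rewrite addrC -mulN1r -finite_functional_lin//; congr p.
by apply/funext => s; rewrite mulN1r addrC.
Qed.

End finite_functionals.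

Lemma finite_functional_comp (R : realType) (S S' : Type) (T : (S' -> R) -> S
  -> R)
    (p : (S -> R) -> R) :
  (forall s, finite_functional (fun f => T f s)) -> finite_functional p ->
  finite_functional (fun f => p (T f)).
Proof.
move=> hT [l pl].
have [m pm] := finite_functional_sum l
  (fun r : R * S => finite_functionalZ r.1 (hT r.2)).
by exists m => f; rewrite pl pm.
Qed.

(* A normed space of functions on [carrier]; [nle f L] reads "[f] belongs to
   the space and has norm at most [L]". *)
Record fspace (R : realType) := FSpace {
  carrier : Type;
  nle : (carrier -> R) -> R -> Prop;
  nle_ge0 : forall f L, nle f L -> 0 <= L;
  nle0 : forall L, 0 <= L -> nle (fun=> 0) L;
  nleD : forall f g L K, nle f L -> nle g K -> nle (fun x => f x + g x) (L + K);
  nleN : forall f L, nle f L -> nle (fun x => - f x) L;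
  nle_mono : forall f L K, nle f L -> L <= K -> nle f K }.

Section morphisms.
Context (R : realType).
Implicit Types V W X : fspace R.

(* Row-finiteness is what makes the adjoint of [T] map evaluations to finite
   combinations of evaluations, hence free space to free space. *)
Definition bounded_op V W (T : (carrier V -> R) -> carrier W -> R) : Prop :=
  (forall s, finite_functional (fun f => T f s)) /\
  exists2 C, 0 <= C & forall f L, nle f L -> nle (T f) (C * L).

Definition complemented V W : Prop := exists T U,
  [/\ @bounded_op V W T, @bounded_op W V U &
      forall f L, nle f L -> U (T f) = f].

Definition fiso V W : Prop := exists T U,
  [/\ @bounded_op V W T, @bounded_op W V U,
      forall f L, nle f L -> U (T f) = f &
      forall g L, nle g L -> T (U g) = g].

Lemma bounded_op_id V : @bounded_op V V id.
Proof.
split; first by move=> s; exact: finite_functional_eval.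
by exists 1 => // f L; rewrite mul1r.
Qed.

Lemma bounded_op_comp V W X T U : @bounded_op V W T -> @bounded_op W X U ->
  @bounded_op V X (U \o T).
Proof.
move=> [Tf [C C0 TC]] [Uf [K K0 UK]]; split.
  by move=> s; apply: (finite_functional_comp Tf (Uf s)).
exists (K * C); first exact: mulr_ge0.
by move=> f L fL; rewrite -mulrA; exact/UK/TC.
Qed.

Lemma bounded_opB V W T U : @bounded_op V W T -> @bounded_op V W U ->
  @bounded_op V W (fun f s => T f s - U f s).
Proof.
move=> [Tf [C C0 TC]] [Uf [K K0 UK]]; split.
  by move=> s; exact: finite_functionalB.
exists (C + K); first exact: addr_ge0.
by move=> f L fL; rewrite mulrDl; apply: nleD; [exact: TC|exact/nleN/UK].
Qed.

Lemma complemented_trans V W X :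
  complemented V W -> complemented W X -> complemented V X.
Proof.
move=> [T [U [bT bU UT]]] [T' [U' [bT' bU' UT']]].
exists (T' \o T), (U \o U'); split; [exact: bounded_op_comp..|].
move=> f L fL /=; have [_ [C _ TC]] := bT.
by rewrite (UT' _ _ (TC _ _ fL)) (UT _ _ fL).
Qed.

Lemma fiso_complemented V W : fiso V W -> complemented V W.
Proof. by move=> [T [U [bT bU UT _]]]; exists T, U. Qed.

Lemma fiso_sym V W : fiso V W -> fiso W V.
Proof. by move=> [T [U [bT bU UT TU]]]; exists U, T. Qed.

Lemma fiso_trans V W X : fiso V W -> fiso W X -> fiso V X.
Proof.
move=> [T [U [bT bU UT TU]]] [T' [U' [bT' bU' UT' TU']]].
exists (T' \o T), (U \o U'); split; [exact: bounded_op_comp..| |].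
  move=> f L fL /=; have [_ [C _ TC]] := bT.
  by rewrite (UT' _ _ (TC _ _ fL)) (UT _ _ fL).
move=> f L fL /=; have [_ [C _ TC]] := bU'.
by rewrite (TU _ _ (TC _ _ fL)) (TU' _ _ fL).
Qed.

Lemma fiso_refl V : fiso V V.
Proof. by exists id, id; split=> //; exact: bounded_op_id. Qed.

End morphisms.

Section sums.
Context (R : realType).
Implicit Types V W X : fspace R.

Definition fsum V W : fspace R.
Proof.
refine (@FSpace R (carrier V + carrier W)
  (fun f L => nle (f \o inl) L /\ nle (f \o inr) L) _ _ _ _ _).
- by move=> f L [/nle_ge0].
- by move=> L L0; split; exact: nle0.
- by move=> f g L K [? ?] [? ?]; split; exact: nleD.
- by move=> f L [? ?]; split; exact: nleN.
- by move=> f L K [? ?] LK; split; apply: nle_mono LK.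
Defined.

(* The condition [0 <= L] matters for empty [I]. *)
Definition flinf (I : Type) V : fspace R.
Proof.
refine (@FSpace R (I * carrier V)
  (fun f L => 0 <= L /\ forall i, nle (fun s => f (i, s)) L) _ _ _ _ _).
- by move=> f L [].
- by move=> L L0; split=> // i; exact: nle0.
- move=> f g L K [L0 ?] [K0 ?]; split; first exact: addr_ge0.
  by move=> i; exact: nleD.
- by move=> f L [L0 ?]; split=> // i; exact: nleN.
- move=> f L K [L0 ?] LK; split; first exact: le_trans LK.
  by move=> i; apply: nle_mono LK.
Defined.

Definition fsum_map (A A' B B' : Type) (T : (A -> R) -> B -> R)
    (T' : (A' -> R) -> B' -> R) (f : A + A' -> R) (s : B + B') : R :=
  match s with inl b => T (f \o inl) b | inr b => T' (f \o inr) b end.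

Lemma bounded_op_fsum V V' W W' T T' :
  @bounded_op R V W T -> @bounded_op R V' W' T' ->
  @bounded_op R (fsum V V') (fsum W W') (fsum_map T T').
Proof.
move=> [Tf [C C0 TC]] [Tf' [C' C0' TC']]; split.
  move=> [s|s] /=.
    by apply: (finite_functional_comp (T := fun f => f \o inl) _ (Tf s)) => r;
      exact: finite_functional_eval.
  by apply: (finite_functional_comp (T := fun f => f \o inr) _ (Tf' s)) => r;
    exact: finite_functional_eval.
exists (C + C'); first exact: addr_ge0.
move=> f L [fl fr]; have L0 := nle_ge0 fl; split.
  by apply: nle_mono (TC _ _ fl) _; rewrite ler_wpM2r// lerDl.
by apply: nle_mono (TC' _ _ fr) _; rewrite ler_wpM2r// lerDr.
Qed.

Lemma fsum_ext (A B : Type) (f g : A + B -> R) :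
  f \o inl = g \o inl -> f \o inr = g \o inr -> f = g.
Proof.
move=> l r; apply/funext => -[s|s]; [exact: (congr1 (@^~ s) l)|].
exact: (congr1 (@^~ s) r).
Qed.

Lemma fiso_fsum V V' W W' : fiso V W -> fiso V' W' ->
  fiso (fsum V V') (fsum W W').
Proof.
move=> [T [U [bT bU UT TU]]] [T' [U' [bT' bU' UT' TU']]].
exists (fsum_map T T'), (fsum_map U U'); split; [exact: bounded_op_fsum..| |].
  by move=> f L [fl fr]; apply: fsum_ext; [apply: UT fl|apply: UT' fr].
by move=> f L [fl fr]; apply: fsum_ext; [apply: TU fl|apply: TU' fr].
Qed.

Lemma complemented_fsum V V' W W' : complemented V W -> complemented V' W' ->
  complemented (fsum V V') (fsum W W').
Proof.
move=> [T [U [bT bU UT]]] [T' [U' [bT' bU' UT']]].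
exists (fsum_map T T'), (fsum_map U U'); split; [exact: bounded_op_fsum..|].
by move=> f L [fl fr]; apply: fsum_ext; [apply: UT fl|apply: UT' fr].
Qed.

Definition flinf_map (I A B : Type) (T : (A -> R) -> B -> R)
  (f : I * A -> R) (s : I * B) : R := T (fun a => f (s.1, a)) s.2.

Lemma bounded_op_flinf I V W T : @bounded_op R V W T ->
  @bounded_op R (flinf I V) (flinf I W) (flinf_map T).
Proof.
move=> [Tf [C C0 TC]]; split.
  move=> [i s]; apply: (finite_functional_comp
    (T := fun f a => f (i, a)) _ (Tf s)) => r; exact: finite_functional_eval.
exists C => // f L [L0 fL]; split; first exact: mulr_ge0.
by move=> i; exact: (TC _ _ (fL i)).
Qed.

Lemma flinf_ext (I A : Type) (f g : I * A -> R) :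
  (forall i, (fun a => f (i, a)) = (fun a => g (i, a))) -> f = g.
Proof. by move=> h; apply/funext => -[i a]; exact: (congr1 (@^~ a) (h i)). Qed.

Lemma fiso_flinf I V W : fiso V W -> fiso (flinf I V) (flinf I W).
Proof.
move=> [T [U [bT bU UT TU]]].
exists (flinf_map T), (flinf_map U); split; [exact: bounded_op_flinf..| |].
  by move=> f L [L0 fL]; apply: flinf_ext => i; apply: UT (fL i).
by move=> f L [L0 fL]; apply: flinf_ext => i; apply: TU (fL i).
Qed.

Lemma complemented_flinf I V W :
  complemented V W -> complemented (flinf I V) (flinf I W).
Proof.
move=> [T [U [bT bU UT]]].
exists (flinf_map T), (flinf_map U); split; [exact: bounded_op_flinf..|].
by move=> f L [L0 fL]; apply: flinf_ext => i; apply: UT (fL i).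
Qed.

Lemma fiso_reindex V W (a : carrier W -> carrier V)
    (b : carrier V -> carrier W) : cancel a b -> cancel b a ->
  (forall f L, nle f L <-> nle (f \o a) L) -> fiso V W.
Proof.
move=> ab ba h; exists (fun f => f \o a), (fun g => g \o b); split.
- split; first by move=> s; exact: finite_functional_eval.
  by exists 1 => // f L /h; rewrite mul1r.
- split; first by move=> s; exact: finite_functional_eval.
  exists 1 => // f L fL; rewrite mul1r; apply/h.
  by have -> : (f \o b) \o a = f by apply/funext => s /=; rewrite ab.
- by move=> f L _; apply/funext => s /=; rewrite ba.
- by move=> f L _; apply/funext => s /=; rewrite ab.
Qed.

Lemma fiso_fsumC V W : fiso (fsum V W) (fsum W V).
Proof.
pose sw (A B : Type) (s : A + B) : B + A :=
  match s with inl x => inr x | inr x => inl x end.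
apply: (@fiso_reindex (fsum V W) (fsum W V) (@sw _ _) (@sw _ _)).
- by case.
- by case.
- by move=> f L; split=> -[].
Qed.

Lemma fiso_fsumA V W X : fiso (fsum V (fsum W X)) (fsum (fsum V W) X).
Proof.
pose a (s : (carrier V + carrier W) + carrier X) :
    carrier V + (carrier W + carrier X) :=
  match s with inl (inl x) => inl x | inl (inr x) => inr (inl x)
  | inr x => inr (inr x) end.
pose b (s : carrier V + (carrier W + carrier X)) :
    (carrier V + carrier W) + carrier X :=
  match s with inl x => inl (inl x) | inr (inl x) => inl (inr x)
  | inr (inr x) => inr x end.
apply: (@fiso_reindex (fsum V (fsum W X)) (fsum (fsum V W) X) a b).
- by do 2?case.
- by do 2?case.
- by move=> f L; split=> [[? []]|[[]]].
Qed.

Lemma fiso_flinfS V : fiso (flinf nat V) (fsum V (flinf nat V)).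
Proof.
pose a (s : carrier V + nat * carrier V) : nat * carrier V :=
  match s with inl x => (0%N, x) | inr p => (p.1.+1, p.2) end.
pose b (s : nat * carrier V) : carrier V + nat * carrier V :=
  match s.1 with 0%N => inl s.2 | n.+1 => inr (n, s.2) end.
apply: (@fiso_reindex (flinf nat V) (fsum V (flinf nat V)) a b).
- by case=> // -[].
- by case=> -[].
- move=> f L; split=> [[L0 fL]|[f0 [L0 fS]]].
    by split; [exact: (fL 0%N)|split=> // i; exact: (fL i.+1)].
  by split=> // -[|i]; [exact: f0|exact: (fS i)].
Qed.

Lemma fiso_flinf_fsum I V W :
  fiso (flinf I (fsum V W)) (fsum (flinf I V) (flinf I W)).
Proof.
pose a (s : I * carrier V + I * carrier W) : I * (carrier V + carrier W) :=
  match s with inl p => (p.1, inl p.2) | inr p => (p.1, inr p.2) end.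
pose b (s : I * (carrier V + carrier W)) : I * carrier V + I * carrier W :=
  match s.2 with inl x => inl (s.1, x) | inr x => inr (s.1, x) end.
apply: (@fiso_reindex (flinf I (fsum V W)) (fsum (flinf I V) (flinf I W)) a b).
- by do 2?case.
- by case=> ? [].
- move=> f L; split=> [[L0 fL]|[[L0 fl] [_ fr]]].
    by split; split=> // i; have [] := fL i.
  by split=> // i; split; [exact: (fl i)|exact: (fr i)].
Qed.

Lemma fiso_flinf_flinf V : fiso (flinf nat (flinf nat V)) (flinf nat V).
Proof.
have [p [q [pq qp]]] : exists (p : nat -> nat * nat) (q : nat * nat -> nat),
    cancel p q /\ cancel q p.
  have /card_set_bijP[h hb] := card_esym card_nat2.
  have bh : bijective h by rewrite -setTT_bijective.
  by have [q pq qp] := bh; exists h, q.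
apply: (@fiso_reindex (flinf nat (flinf nat V)) (flinf nat V)
  (fun s => ((p s.1).1, ((p s.1).2, s.2)))
  (fun s => (q (s.1, s.2.1), s.2.2))).
- by case=> n s /=; rewrite -surjective_pairing pq.
- by case=> n [m s] /=; rewrite qp.
- move=> f L; split=> [[L0 fL]|[L0 fL]]; split=> // n.
    by have [_ fp] := fL (p n).1; exact: (fp (p n).2).
  by split=> // m; have := fL (q (n, m)); rewrite /= qp.
Qed.

Lemma complemented_flinf_inj (I : countType) V :
  complemented (flinf I V) (flinf nat V).
Proof.
exists (fun f s => if unpickle s.1 is Some i then f (i, s.2) else 0),
  (fun f s => f (pickle s.1, s.2)); split.
- split=> [[n s]|] /=.
    by case: unpickle => [i|]; [exact: finite_functional_eval|
      exact: finite_functional0].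
  exists 1 => // f L [L0 fL]; rewrite mul1r; split=> // n /=.
  by case: unpickle => [i|]; [exact: (fL i)|exact: nle0].
- split=> [[n s]|] /=; first exact: finite_functional_eval.
  by exists 1 => // f L [L0 fL]; rewrite mul1r; split=> // n /=;
    exact: (fL (pickle n)).
- by move=> f L _; apply/funext => -[i s] /=; rewrite pickleK.
Qed.

Lemma complemented_fsuml V W : complemented V (fsum V W).
Proof.
exists (fun f s => match s with inl x => f x | inr _ => 0 end),
  (fun f s => f (inl s)); split=> //.
- split; first by case=> s; [exact: finite_functional_eval|
      exact: finite_functional0].
  exists 1 => // f L fL; rewrite mul1r; split=> //=.
  exact/nle0/(nle_ge0 fL).
- split; first by move=> s; exact: finite_functional_eval.
  by exists 1 => // f L [] fL _; rewrite mul1r.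
Qed.

Definition fker V (P : (carrier V -> R) -> carrier V -> R)
  (Pf : forall s, finite_functional (fun f => P f s)) : fspace R.
Proof.
refine (@FSpace R (carrier V) (fun f L => nle f L /\ P f = (fun=> 0))
  _ _ _ _ _).
- by move=> f L [/nle_ge0].
- move=> L L0; split; first exact: nle0.
  apply/funext => s; have [l ->] := Pf s.
  by rewrite big1// => r _; rewrite mulr0.
- move=> f g L M [fL f0] [gM g0]; split; first exact: nleD.
  apply/funext => s; rewrite (finite_functional_add f g (Pf s)).
  by rewrite f0 g0 addr0.
- move=> f L [fL f0]; split; first exact: nleN.
  apply/funext => s; have [l pl] := Pf s.
  rewrite pl -[RHS]oppr0 -[in RHS](congr1 (@^~ s) f0)/= pl -sumrN.
  by apply: eq_bigr => r _; rewrite mulrN.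
- by move=> f L M [fL f0] LM; split=> //; apply: nle_mono LM.
Defined.

(** [T \o U] is a projection of [W] onto a copy of [V]; [K] is its kernel, and [f] corresponds to
    the pair of [U f] and [f - T (U f)]. *)
Lemma complemented_split V W : complemented V W ->
  exists K, fiso W (fsum V K).
Proof.
move=> [T [U [bT bU UT]]].
have TU_fin s : finite_functional (fun f => T (U f) s).
  by have [+ _] := bounded_op_comp bU bT; exact.
pose K := fker TU_fin.
have bTU := bounded_op_comp bU bT.
exists K; exists (fun f s => match s with inl x => U f x
    | inr x => f x - T (U f) x end), (fun f s => T (f \o inl) s + f (inr s)).
have [Uf [C C0 UC]] := bU; have [Tf [D D0 TD]] := bT.
have UTU f L : nle f L -> U (T (U f)) = U f.
  by move=> fL; exact: UT (UC _ _ fL).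
split.
- split=> [[s|s]|]; first exact: Uf.
    by apply: finite_functionalB; [exact: finite_functional_eval|exact: TU_fin].
  have [_ [B B0 hB]] := bounded_opB (bounded_op_id W) bTU.
  exists (B + C); first exact: addr_ge0.
  move=> f L fL; have L0 := nle_ge0 fL; split; last split.
  + by apply: nle_mono (UC _ _ fL) _; rewrite ler_wpM2r// lerDr.
  + by apply: nle_mono (hB _ _ fL) _; rewrite ler_wpM2r// lerDl.
  + apply/funext => s /=.
    rewrite (finite_functional_sub f (T (U f)) (TU_fin s)).
    by rewrite (UTU _ _ fL) subrr.
- split=> [s|].
    apply: finite_functionalD; last exact: finite_functional_eval.
    apply: (finite_functional_comp (T := fun f => f \o inl) _ (Tf s)) => r.
    exact: finite_functional_eval.
  exists (D + 1); first exact: addr_ge0.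
  move=> f L [fl [fr _]]; rewrite mulrDl mul1r.
  by apply: nleD => //; exact: TD.
- by move=> f L fL; apply/funext => s /=; rewrite addrC subrK.
- move=> f L [fl [fr /= fr0]].
  have {}fr0 : T (U (f \o inr)) = (fun=> 0) by exact: fr0.
  have Ufr : U (f \o inr) = (fun=> 0).
    rewrite -(UTU _ _ fr) fr0; apply/funext => s; have [l ->] := Uf s.
    by rewrite big1// => r _; rewrite mulr0.
  have Uf' : U (fun s => T (f \o inl) s + f (inr s)) = f \o inl.
    apply/funext => s; rewrite (finite_functional_add _ _ (Uf s)).
    by rewrite (UT _ _ fl) (congr1 (@^~ s) Ufr) addr0.
  apply/funext => -[s|s] /=; rewrite Uf'//.
  by rewrite addrAC subrr add0r.
Qed.

(** With [Y] for [flinf nat V]: [Y ~ flinf nat Y ~ Y + flinf nat Y ~ Y + Y]. *)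
Lemma fiso_flinf_double V :
  fiso (flinf nat V) (fsum (flinf nat V) (flinf nat V)).
Proof.
have Yinf := fiso_sym (fiso_flinf_flinf V).
apply: (fiso_trans Yinf); apply: (fiso_trans (fiso_flinfS _)).
by apply: fiso_fsum; [exact: fiso_refl|exact: fiso_sym Yinf].
Qed.

(* Pelczynski's decomposition method: with [V ~ Y + B] and [Y ~ V + A],
   [V ~ Y + Y + B ~ V + Y], and [Y ~ ell_infty(V + A) ~ V + Y]. *)
Lemma fiso_of_complemented V V0 : complemented V (flinf nat V0) ->
  complemented (flinf nat V0) V -> fiso V (flinf nat V0).
Proof.
set Y := flinf nat V0 => VY YV.
have [A YVA] := complemented_split VY; have [B VYB] := complemented_split YV.
have Yinf : fiso Y (flinf nat Y) by apply/fiso_sym/fiso_flinf_flinf.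
have YYY : fiso Y (fsum Y Y) := fiso_flinf_double V0.
have VV : fiso V (fsum V Y).
  apply: fiso_trans (fiso_fsumC _ _).
  apply: (fiso_trans VYB); apply: fiso_trans (fiso_fsum YYY (fiso_refl B)) _.
  apply: fiso_trans (fiso_sym (fiso_fsumA _ _ _)) _.
  by apply: fiso_fsum; [exact: fiso_refl|exact: fiso_sym VYB].
apply: (fiso_trans VV); apply: fiso_sym.
have infVA : fiso Y (fsum (flinf nat V) (flinf nat A)).
  apply: (fiso_trans Yinf); apply: fiso_trans (fiso_flinf nat YVA) _.
  exact: fiso_flinf_fsum.
apply: (fiso_trans infVA).
apply: (fiso_trans (fiso_fsum (fiso_flinfS V) (fiso_refl _))).
apply: (fiso_trans (fiso_sym (fiso_fsumA _ _ _))).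
by apply: fiso_fsum; [exact: fiso_refl|exact: fiso_sym infVA].
Qed.

End sums.

(** * Packing and Whitney partitions *)

Lemma maximal_seq (T : Type) (P : seq T -> Prop) (N : nat) : P [::] ->
  (forall s, P s -> (size s <= N)%N) ->
  exists2 s, P s & forall s', P s' -> (size s' <= size s)%N.
Proof.
move=> P0 PN; pose Q n := `[< exists2 s, P s & size s = n >].
have exQ : exists n, Q n by exists 0%N; apply/asboolP; exists [::].
have QN n : Q n -> (n <= N)%N by move=> /asboolP[s /PN sN <-].
case: (ex_maxnP exQ QN) => n /asboolP[s Ps <-] smax.
by exists s => // s' Ps'; apply: smax; apply/asboolP; exists s'.
Qed.

Lemma bounded_pred_seq (T : eqType) (P : pred T) (N : nat) :
  (forall s, uniq s -> all P s -> (size s <= N)%N) ->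
  exists s, [/\ uniq s, (size s <= N)%N & s =i P].
Proof.
move=> PN.
have [||s /andP[us Ps] smax] :=
    @maximal_seq T (fun s => uniq s && all P s) N => //.
  by move=> s /andP[]; exact: PN.
exists s; split=> //; first exact: PN.
move=> x; apply/idP/idP => [/(allP Ps)//|Px].
apply: contraT => xs; have := smax (x :: s).
have {}Px : P x := Px.
by rewrite /= xs us Ps Px ltnn => /(_ isT).
Qed.

Lemma greedy_selection (P : nat -> Prop) (Q : nat -> nat -> Prop) :
  exists sel : pred nat, forall n,
    sel n <-> P n /\ forall k, (k < n)%N -> sel k -> Q n k.
Proof.
pose ok n (s : seq nat) := `[< P n /\ forall k, k \in s -> Q n k >].
(* [sels n] lists the indices below [n] selected so far, so that the recursion is structural
   although the test for [n] involves all earlier choices. *)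
pose fix sels n := if n is m.+1 then
  if ok m (sels m) then m :: sels m else sels m else [::].
have selsP n k : (k \in sels n) = (k < n)%N && ok k (sels k).
  elim: n k => [|n IH] k //=; rewrite ltnS leq_eqVlt.
  case: (eqVneq k n) => [->|kn] /=.
    by case: ifP => [okn|nok]; rewrite ?mem_head// IH ltnn.
  by case: ifP => _; rewrite ?in_cons ?(negbTE kn) IH.
exists (fun n => ok n (sels n)) => n; split.
  move=> /asboolP[Pn Qn]; split=> // k kn okk.
  by apply: Qn; rewrite selsP kn.
move=> [Pn Qn]; apply/asboolP; split=> // k; rewrite selsP => /andP[kn okk].
exact: Qn.
Qed.

Section distance_to_a_set.
Context (R : realType) (Z : metricType R) (A : set Z).
Hypothesis A0 : A !=set0.

Definition dist_to (x : Z) : R := inf [set mdist x a | a in A].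

Let has_inf_dist x : has_inf [set mdist x a | a in A].
Proof.
split; first by have [a Aa] := A0; exists (mdist x a), a.
by exists 0 => _ [a _ <-]; exact: mdist_ge0.
Qed.

Lemma dist_to_le x a : A a -> dist_to x <= mdist x a.
Proof. by move=> Aa; apply: ge_inf; [case: (has_inf_dist x)|exists a]. Qed.

Lemma dist_to_ge x e : (forall a, A a -> e <= mdist x a) -> e <= dist_to x.
Proof.
move=> h; apply: lb_le_inf; first by case: (has_inf_dist x).
by move=> _ [a Aa <-]; exact: h.
Qed.

Lemma dist_to_near x : 0 < dist_to x ->
  exists2 a, A a & mdist x a <= 2 * dist_to x.
Proof.
move=> x0; have [_ [a Aa <-] /ltW h] := inf_adherent x0 (has_inf_dist x).
by exists a => //; rewrite mulrDl !mul1r.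
Qed.

Lemma dist_to_lip x y : dist_to x <= mdist x y + dist_to y.
Proof.
rewrite -lerBlDl; apply: dist_to_ge => a Aa; rewrite lerBlDl.
exact: le_trans (dist_to_le x Aa) (metric_triangle _ _ _).
Qed.

End distance_to_a_set.

Section packing.
Context (R : realType) (Z : metricType R).

(* A form of the doubling condition that needs no centers in [D]: it passes to
   subsets, bi-Lipschitz images and finite unions at once. *)
Definition packing (D : set Z) : Prop :=
  forall kappa : R, 0 < kappa -> exists N : nat, forall (r : R) (s : seq Z),
    0 < r -> (forall x, x \in s -> D x) ->
    pairwise (fun x y => kappa * r <= mdist x y <= r) s -> (size s <= N)%N.

(** A maximal [1 / (m + 1)]-separated list in the part of [D] within [m] of [b] exists by packing,
    and by maximality it is a net; the sequence enumerates these nets over all [m]. *)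
Lemma packing_dense_sequence (D : set Z) (b : Z) : packing D -> D b ->
  exists q : nat -> Z, (forall n, D (q n)) /\
    forall x e, D x -> 0 < e -> exists n, mdist x (q n) < e.
Proof.
move=> pD Db.
have net (m : nat) : exists s : seq Z, (forall y, y \in s -> D y) /\
    forall x, D x -> mdist x b <= m%:R ->
      exists2 y, y \in s & mdist x y < m.+1%:R^-1.
  pose e : R := m.+1%:R^-1; pose r : R := 2 * m.+1%:R.
  have e0 : 0 < e by rewrite invr_gt0.
  have r0 : 0 < r by rewrite mulr_gt0.
  have [N hN] := pD (e / r) (divr_gt0 e0 r0).
  pose P s := (forall y, y \in s -> D y /\ mdist y b <= m%:R) /\
    pairwise (fun x y => e <= mdist x y) s.
  have [|s [sD se]|s [sD se] smax] := @maximal_seq Z P N.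
  - by split.
  - apply: (hN r) => //; first by move=> x /sD[].
    apply: (@sub_in_pairwise _ (mem s) _ _ _ s (allss s) se).
    move=> x y xs ys exy; rewrite divfK ?gt_eqF// exy/=.
    have [[_ xb] [_ yb]] := (sD x xs, sD y ys).
    rewrite (le_trans (metric_triangle _ b _))// (metric_sym b).
    by rewrite (le_trans (lerD xb yb))// -mulr2n -[_ *+ 2]mulr_natl
      ler_wpM2l// ler_nat.
  exists s; split=> [y /sD[]//|x Dx xb]; apply: contrapT => h.
  suff /smax : P (x :: s) by rewrite ltnn.
  split=> [y|]; first by rewrite in_cons => /orP[/eqP ->//|/sD].
  rewrite /= se andbT; apply/allP => y ys; rewrite leNgt; apply/negP => xy.
  by apply: h; exists y.
have [s hs] := choice net.
(* [n] codes a pair: the [k]-th point of the [m]-th net, or [b], a point of [D], when [k] is out of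
   range. *)
exists (fun n => let: (m, k) := odflt (0, 0)%N (unpickle n) in nth b (s m) k).
split=> [n|x e Dx e0].
  case: (odflt _ _) => m k; have [kl|kl] := ltnP k (size (s m)).
    by have [h _] := hs m; apply/h/mem_nth.
  by rewrite nth_default.
pose m := Num.bound (mdist x b + e^-1).
have [_ /(_ x Dx)] := hs m.
have bm : mdist x b + e^-1 < m%:R.
  by apply: archi_boundP; rewrite addr_ge0 ?mdist_ge0// invr_ge0 ltW.
case=> [|y ys xy].
  by rewrite (le_trans _ (ltW bm))// lerDl invr_ge0 ltW.
exists (pickle (m, index y (s m))); rewrite pickleK/= nth_index//.
apply: (lt_trans xy); rewrite invf_plt ?posrE//.
apply: (le_lt_trans _ (lt_le_trans bm _)); last by rewrite ler_nat.
by rewrite lerDr mdist_ge0.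
Qed.

Lemma packing_union (D E : set Z) : packing D -> packing E ->
  packing (D `|` E).
Proof.
move=> pD pE k k0; have [N hN] := pD k k0; have [M hM] := pE k k0.
exists (N + M)%N => r s r0 sDE ps.
rewrite -(count_predC (fun x => `[< D x >])) -!size_filter leq_add//.
  apply: (hN r) => //; last exact: pairwise_filter.
  by move=> x; rewrite mem_filter => /andP[/asboolP].
apply: (hM r) => //; last exact: pairwise_filter.
move=> x; rewrite mem_filter => /andP[/= /asboolPn nDx /sDE].
by case.
Qed.

Lemma packing_sub (D E : set Z) : D `<=` E -> packing E -> packing D.
Proof.
move=> DE pE k k0; have [N hN] := pE k k0; exists N => r s r0 sD.
by apply: hN => // x /sD/DE.
Qed.

Lemma packing_set0 : packing set0.
Proof.
move=> k k0; exists 0%N => r [|x s] // r0 h.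
by have := h x (mem_head _ _).
Qed.

End packing.

Lemma packing_bilip (R : realType) (Z Y : metricType R) (D : set Z)
    (E : set Y) (phi : Z -> Y) (c C : R) : 0 < c -> 0 < C ->
  (forall x, D x -> E (phi x)) ->
  (forall x y, D x -> D y ->
    c * mdist x y <= mdist (phi x) (phi y) <= C * mdist x y) ->
  packing E -> packing D.
Proof.
move=> c0 C0 DE bp pE k k0.
have [N hN] := pE (c * k / C) (divr_gt0 (mulr_gt0 c0 k0) C0).
exists N => r s r0 sD ps; rewrite -(size_map phi).
apply: (hN (C * r)); first exact: mulr_gt0.
  by move=> _ /mapP[x /sD xD ->]; exact: DE.
rewrite pairwise_map.
apply: (@sub_in_pairwise _ (mem s) _ _ _ s (allss s) ps).
move=> x y xs ys /andP[l u]; have /andP[l' u'] := bp x y (sD x xs) (sD y ys).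
rewrite /= (le_trans u') ?ler_wpM2l ?(ltW C0)// andbT.
apply: le_trans l'.
have -> : c * k / C * (C * r) = c * (k * r) by field; rewrite gt_eqF.
by rewrite ler_wpM2l// ltW.
Qed.

Section partition_of_unity.
Context (R : realType) (Z : metricType R) (D A : set Z).
Hypothesis A0 : A !=set0.
Hypothesis rho0 : forall x, D x -> ~ A x -> 0 < dist_to A x.

Let rho := dist_to A.

(** A Whitney partition of unity on [D] minus [A]: the pieces may steepen like the inverse distance
    to [A]. The list [J x] may contain inactive indices. *)
Definition unity_partition (I : eqType) (J : Z -> seq I) (psi : I -> Z -> R)
    (N : nat) (K : R) : Prop :=
  [/\ 0 <= K,
      forall i x, 0 <= psi i x <= 1,
      forall x, D x -> ~ A x ->
        [/\ uniq (J x), (size (J x) <= N)%N,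
            forall i, psi i x != 0 -> i \in J x &
            \sum_(i <- J x) psi i x = 1] &
      forall i x y, D x -> ~ A x -> D y -> ~ A y ->
        mdist x y <= dist_to A x / 2 ->
        `|psi i x - psi i y| <= K * mdist x y / dist_to A x].

(** Whitney's extension formula, with a function [v i] in place of a constant on piece [i]. *)
Definition glue (I : eqType) (J : Z -> seq I) (psi : I -> Z -> R)
    (h : Z -> R) (v : I -> Z -> R) (x : Z) : R :=
  if `[< A x >] then h x else \sum_(i <- J x) psi i x * v i x.

(** If the points are far apart compared with their distance to [A], both values are compared with
    [h a] for some [a] in [A] close by. Otherwise [h a] is subtracted from every [v i], which is
    harmless as the weights sum to 1, and the product rule bounds each of at most [2 * N] terms: the
    slope [K / dist_to A x] of a weight meets a factor [v i - h a] of order [L * dist_to A x]. *)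
Lemma glue_lipschitz (I : eqType) (J : Z -> seq I) psi N K h v L :
  unity_partition J psi N K -> 0 <= L ->
  (forall a b, A a -> A b -> `|h a - h b| <= L * mdist a b) ->
  (forall i x a, D x -> ~ A x -> i \in J x -> psi i x != 0 -> A a ->
     `|v i x - h a| <= L * mdist x a) ->
  (forall i x y, D x -> ~ A x -> D y -> ~ A y -> psi i x != 0 ->
     psi i y != 0 -> `|v i x - v i y| <= L * mdist x y) ->
  forall x y, D x -> D y ->
    `|glue J psi h v x - glue J psi h v y| <=
      (2 * N%:R * (1 + 3 * K) + 9) * L * mdist x y.
Proof.
move=> [K0 psi01 pJ psiL] L0 hL vh vL.
set u := glue J psi h v; set C := _ + 9.
have C9 : 9 <= C.
  by rewrite /C lerDr mulr_ge0 ?mulr_ge0 ?ler0n// addr_ge0// mulr_ge0.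
have uA x : A x -> u x = h x by move=> Ax; rewrite /u /glue asboolT.
have unA x : ~ A x -> u x = \sum_(i <- J x) psi i x * v i x.
  by move=> Ax; rewrite /u /glue asboolF.
have uh x a : D x -> A a -> `|u x - h a| <= L * mdist x a.
  move=> Dx Aa; have [Ax|nAx] := pselect (A x); first by rewrite uA// hL.
  have [_ _ _ s1] := pJ x Dx nAx.
  rewrite unA// -[h a]mul1r -s1 mulr_suml -sumrB.
  apply: (le_trans (ler_norm_sum _ _ _)).
  apply: (@le_trans _ _ (\sum_(i <- J x) psi i x * (L * mdist x a))).
    rewrite big_seq [leRHS]big_seq; apply: ler_sum => i iJ.
    have /andP[p0 _] := psi01 i x.
    rewrite -mulrBr normrM ger0_norm//.
    have [->|pn0] := eqVneq (psi i x) 0; first by rewrite !mul0r.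
    by rewrite ler_wpM2l// vh.
  by rewrite -mulr_suml s1 mul1r.
(* Passing through [a] costs [L * (mdist x a + mdist y a)], hence the [4 + 5 = 9] in the
   constant. *)
have far x y a : D x -> D y -> A a -> mdist x a <= 4 * mdist x y ->
    `|u x - u y| <= C * L * mdist x y.
  move=> Dx Dy Aa xa.
  have ya : mdist y a <= 5 * mdist x y.
    by rewrite (le_trans (metric_triangle _ x _))// metric_sym; lra.
  have -> : u x - u y = (u x - h a) - (u y - h a) by ring.
  rewrite (le_trans (ler_normB _ _))//.
  apply: (le_trans (lerD (uh _ _ Dx Aa) (uh _ _ Dy Aa))).
  rewrite -mulrDr [C * L]mulrC -mulrA ler_wpM2l//.
  have := mdist_ge0 x y; nra.
move=> x y Dx Dy.
have [Ax|nAx] := pselect (A x).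
  by apply: (far _ _ x) => //; rewrite mdistxx mulr_ge0// mdist_ge0.
have [Ay|nAy] := pselect (A y).
  apply: (far _ _ y) => //; have := mdist_ge0 x y; lra.
have rx := rho0 Dx nAx; have [a Aa xa] := dist_to_near A0 rx.
have [xy|/ltW xy] := leP (mdist x y) (dist_to A x / 2); last first.
  by apply: (far _ _ a) => //; lra.
have [ux sx px s1x] := pJ x Dx nAx; have [uy sy py s1y] := pJ y Dy nAy.
pose r := undup (J x ++ J y).
have ur : uniq r by exact: undup_uniq.
have sr : (size r <= N + N)%N.
  by rewrite (leq_trans (size_undup _))// size_cat leq_add.
have extend z (w : I -> R) : uniq (J z) -> {subset J z <= r} ->
    (forall i, psi i z != 0 -> i \in J z) ->
    \sum_(i <- J z) psi i z * w i = \sum_(i <- r) psi i z * w i.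
  move=> uz zr pz.
  rewrite [RHS](bigID (mem (J z)))/= [X in _ + X]big1 ?addr0; last first.
    move=> i iJ; have [->|/pz iJ'] := eqVneq (psi i z) 0;
      first by rewrite mul0r.
    by rewrite iJ' in iJ.
  rewrite -[RHS]big_filter; apply: perm_big; apply: uniq_perm => //.
    exact: filter_uniq.
  by move=> i; rewrite mem_filter; case: (boolP (i \in J z)) => // /zr ->.
have sub_x : {subset J x <= r} by move=> i iJ; rewrite mem_undup mem_cat iJ.
have sub_y : {subset J y <= r}.
  by move=> i iJ; rewrite mem_undup mem_cat iJ orbT.
have centered z : ~ A z -> uniq (J z) -> {subset J z <= r} ->
    (forall i, psi i z != 0 -> i \in J z) ->
    \sum_(i <- J z) psi i z = 1 ->
    u z - h a = \sum_(i <- r) psi i z * (v i z - h a).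
  move=> nAz uz zr pz s1; rewrite unA// -[h a in LHS]mul1r -s1 mulr_suml -sumrB.
  rewrite -(extend z (fun i => v i z - h a))//.
  by apply: eq_bigr => i _; rewrite mulrBr.
have -> : u x - u y = (u x - h a) - (u y - h a) by ring.
rewrite (centered x)// (centered y)// -sumrB.
apply: (le_trans (ler_norm_sum _ _ _)).
pose B := (1 + 3 * K) * L * mdist x y.
have B0 : 0 <= B by rewrite !mulr_ge0 ?mdist_ge0// addr_ge0// mulr_ge0.
(* The factor is [1 / 2 + 2], from the bounds on [mdist x y] and [mdist x a]; it is rounded up to
   the 3 in [3 * K]. *)
have ya : mdist y a <= 5 / 2 * dist_to A x.
  by rewrite (le_trans (metric_triangle _ x _))// metric_sym; lra.
have lipterm i w : `|w| <= L * (5 / 2 * dist_to A x) ->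
    `|(psi i x - psi i y) * w| <= 3 * K * L * mdist x y.
  move=> w_le; rewrite normrM.
  apply: (le_trans (ler_pM _ _ (psiL i x y Dx nAx Dy nAy xy) w_le)) => //.
  have -> : K * mdist x y / dist_to A x * (L * (5 / 2 * dist_to A x)) =
      5 / 2 * (K * L * mdist x y) by field; rewrite gt_eqF.
  have : 0 <= K * L * mdist x y by rewrite !mulr_ge0 ?mdist_ge0.
  by lra.
have KLd : 0 <= K * L * mdist x y by rewrite !mulr_ge0 ?mdist_ge0.
have Ld : 0 <= L * mdist x y by rewrite mulr_ge0 ?mdist_ge0.
have vy i : psi i y != 0 -> `|v i y - h a| <= L * (5 / 2 * dist_to A x).
  move=> piy; apply: le_trans (vh _ _ _ Dy nAy (py _ piy) piy Aa) _.
  exact: ler_wpM2l.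
have vx i : psi i x != 0 -> `|v i x - h a| <= L * (5 / 2 * dist_to A x).
  move=> pix; apply: le_trans (vh _ _ _ Dx nAx (px _ pix) pix Aa) _.
  by apply: ler_wpM2l => //; lra.
have term i : `|psi i x * (v i x - h a) - psi i y * (v i y - h a)| <= B.
  have [pix|pix] := eqVneq (psi i x) 0.
    have [piy|piy] := eqVneq (psi i y) 0.
      by rewrite pix piy !mul0r subrr normr0.
    have -> : psi i x * (v i x - h a) - psi i y * (v i y - h a) =
       (psi i x - psi i y) * (v i y - h a) by rewrite pix; ring.
    by apply: (le_trans (lipterm _ _ (vy _ piy))); rewrite /B; lra.
  have [piy|piy] := eqVneq (psi i y) 0.
    have -> : psi i x * (v i x - h a) - psi i y * (v i y - h a) =
       (psi i x - psi i y) * (v i x - h a) by rewrite piy; ring.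
    by apply: (le_trans (lipterm _ _ (vx _ pix))); rewrite /B; lra.
  have -> : psi i x * (v i x - h a) - psi i y * (v i y - h a) =
      psi i x * (v i x - v i y) + (psi i x - psi i y) * (v i y - h a) by ring.
  have /andP[p0 p1] := psi01 i x.
  have v_le : `|psi i x * (v i x - v i y)| <= L * mdist x y.
    rewrite normrM ger0_norm// (le_trans (ler_wpM2l p0 (vL _ _ _ _ _ _ _ pix
      piy)))//.
    by rewrite ler_piMl.
  apply: (le_trans (ler_normD _ _)).
  by apply: (le_trans (lerD v_le (lipterm _ _ (vy _ piy)))); rewrite /B; lra.
apply: (@le_trans _ _ (\sum_(i <- r) B)); first exact: ler_sum.
rewrite big_const_seq count_predT iter_addr_0 -mulr_natr.
apply: (@le_trans _ _ (B * (N + N)%:R)); first by rewrite ler_wpM2l// ler_nat.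
rewrite natrD /C /B; have : 0 <= N%:R :> R by [].
by lra.
Qed.

End partition_of_unity.

Section running_max.
Context (R : realType) (Z : Type) (phi : nat -> Z -> R).
Hypothesis phi01 : forall i x, 0 <= phi i x <= 1.

Fixpoint running_max (n : nat) (x : Z) : R :=
  if n is m.+1 then Num.max (running_max m x) (phi m x) else 0.

(* The increments of the running maxima of bump functions sum to 1 wherever some
   bump is 1, and stay Lipschitz: a partition of unity without division. *)
Definition max_increment i x := running_max i.+1 x - running_max i x.

Lemma running_max01 n x : 0 <= running_max n x <= 1.
Proof.
elim: n => [|n /andP[IH0 IH1]] /=; first by rewrite lexx ler01.
by have /andP[_ p1] := phi01 n x; rewrite le_max IH0 ge_max IH1 p1.
Qed.

Lemma max_increment01 i x : 0 <= max_increment i x <= 1.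
Proof.
have /andP[a0 a1] := running_max01 i x.
have /andP[b0 b1] := running_max01 i.+1 x.
rewrite /max_increment subr_ge0 /= le_max lexx/=.
by move: b1; rewrite /=; lra.
Qed.

Lemma max_increment_neq0 i x : max_increment i x != 0 -> phi i x != 0.
Proof.
apply: contra => /eqP p0; rewrite /max_increment /= p0 max_l ?subrr//.
by have /andP[] := running_max01 i x.
Qed.

Lemma running_max_lip n x y B : (forall i, `|phi i x - phi i y| <= B) ->
  `|running_max n x - running_max n y| <= B.
Proof.
move=> pB; have B0 := le_trans (normr_ge0 _) (pB 0%N).
elim: n => [|n]; first by rewrite subrr normr0.
have := pB n; rewrite /= !ler_norml => /andP[u1 u2] /andP[v1 v2].
by case: (leP (running_max n x)); case: (leP (running_max n y)) => *;
  apply/andP; split; lra.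
Qed.

Lemma max_increment_lip i x y B : (forall i, `|phi i x - phi i y| <= B) ->
  `|max_increment i x - max_increment i y| <= 2 * B.
Proof.
move=> pB; have h1 := running_max_lip i.+1 pB; have h2 := running_max_lip i pB.
have -> : max_increment i x - max_increment i y =
  (running_max i.+1 x - running_max i.+1 y) -
  (running_max i x - running_max i y) by rewrite /max_increment; ring.
by rewrite (le_trans (ler_normB _ _))//; lra.
Qed.

Lemma sum_max_increment (J : seq nat) x k : uniq J ->
  (forall i, phi i x != 0 -> i \in J) -> phi k x = 1 ->
  \sum_(i <- J) max_increment i x = 1.
Proof.
move=> uJ pJ pk.
(* Beyond [k], so that the running maximum has reached 1, and beyond [J], so that the telescoping
   sum contains every active index. *)
pose n := maxn k.+1 (\max_(i <- J) i).+1.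
have Jn i : i \in J -> (i < n)%N.
  by move=> iJ; rewrite /n leq_max [X in _ || X]ltnS leq_bigmax_seq ?orbT.
have kn : (k < n)%N by rewrite leq_maxl.
have <- : running_max n x = 1.
  elim: {Jn} n kn => // n IH; rewrite ltnS leq_eqVlt /= => /orP[/eqP <-|/IH ->].
    by rewrite pk max_r//; have /andP[] := running_max01 k x.
  by rewrite max_l//; have /andP[] := phi01 n x.
have -> : running_max n x = \sum_(0 <= i < n) max_increment i x.
  by rewrite telescope_sumr// /= subr0.
rewrite [RHS](bigID (mem J))/= [X in _ + X]big1 ?addr0; last first.
  move=> i; apply: contraNeq => /max_increment_neq0/pJ; exact.
rewrite -[RHS]big_filter; apply: perm_big; apply: uniq_perm => //.
  by rewrite filter_uniq// iota_uniq.
move=> i; rewrite mem_filter mem_index_iota /=.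
by case: (boolP (i \in J)) => // /Jn ->.
Qed.

End running_max.

Section whitney.
Context (R : realType) (Z : metricType R) (D A : set Z).
Hypothesis A0 : A !=set0.
Hypothesis AD : A `<=` D.
Hypothesis rho0 : forall x, D x -> ~ A x -> 0 < dist_to A x.
Hypothesis pD : packing D.

Definition bump (p : Z) (r : R) (x : Z) : R :=
  Num.max 0 (Num.min 1 (2 - mdist x p / r)).

Lemma bump01 p r x : 0 <= bump p r x <= 1.
Proof. by rewrite /bump le_max lexx/= ge_max ler01/= ge_min lexx. Qed.

Lemma bump_eq1 p r x : 0 < r -> mdist x p <= r -> bump p r x = 1.
Proof.
move=> r0 xr; rewrite /bump min_l ?max_r//.
have : mdist x p / r <= 1 by rewrite ler_pdivrMr// mul1r.
by lra.
Qed.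

Lemma bump_neq0 p r x : 0 < r -> bump p r x != 0 -> mdist x p < 2 * r.
Proof.
move=> r0; apply: contraNlt => xr; rewrite /bump max_l// ge_min.
apply/orP; right; have : 2 <= mdist x p / r by rewrite ler_pdivlMr.
by lra.
Qed.

Lemma bump_lip p r x y : 0 < r -> `|bump p r x - bump p r y| <= mdist x y / r.
Proof.
move=> r0.
have : `|mdist x p / r - mdist y p / r| <= mdist x y / r.
  rewrite -mulrBl normrM [`|r^-1|]ger0_norm ?invr_ge0 ?(ltW r0)//.
  rewrite ler_wpM2r ?invr_ge0 ?(ltW r0)// ler_norml.
  have h1 := metric_triangle x y p; have h2 := metric_triangle y x p.
  by rewrite (metric_sym y x) in h2; apply/andP; split; lra.
rewrite /bump /Num.max /Num.min !ler_norml => /andP[h1 h2].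
by apply/andP; split; repeat case: ifPn; rewrite -?leNgt; lra.
Qed.

(* The centers are selected greedily in a dense sequence [q]: [q n] is rejected
   when it lies within [rho (q k) / 16] of an earlier selected [q k]. *)
Lemma whitney_partition : exists (sel : pred nat) (p al : nat -> Z)
    (J : Z -> seq nat) (psi : nat -> Z -> R) (N : nat) (K : R),
  [/\ forall i, sel i ->
        [/\ D (p i), ~ A (p i), A (al i) & 0 < mdist (p i) (al i)],
      unity_partition D A J psi N K &
      forall i x, D x -> ~ A x -> i \in J x ->
        [/\ sel i, mdist x (p i) <= dist_to A x &
            mdist (p i) (al i) <= 4 * dist_to A x]].
Proof.
set rho := dist_to A.
have [b Ab] := A0.
have [q [qD qdense]] := packing_dense_sequence pD (AD Ab).
have [sel selP] := greedy_selection (fun n => ~ A (q n))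
  (fun n k => rho (q k) / 16 <= mdist (q n) (q k)).
have rho_pos i : sel i -> 0 < rho (q i).
  by move=> /selP[nA _]; exact: rho0.
have lip x y : rho x <= mdist x y + rho y by exact: dist_to_lip.
pose phi i x := if sel i then bump (q i) (rho (q i) / 8) x else 0.
have phi01 i x : 0 <= phi i x <= 1.
  by rewrite /phi; case: ifP => _; [exact: bump01|rewrite lexx ler01].
have phi_neq0 i x : phi i x != 0 -> sel i /\ mdist x (q i) < rho (q i) / 4.
  rewrite /phi; case: ifPn => [si|_]; last by rewrite eqxx.
  move=> h; split=> //; have := bump_neq0 _ h; have := rho_pos _ si.
  by move=> h1 /(_ _); have := divr_gt0 h1 (ltr0n R 8) => h2 /(_ h2); lra.
(* [rho] is 1-Lipschitz, so [rho x] and [rho (q i)] are comparable where bump [i] is active. *)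
have near i x : phi i x != 0 ->
    [/\ sel i, mdist x (q i) < rho (q i) / 4, 4 / 5 * rho x <= rho (q i)
      & rho (q i) <= 4 / 3 * rho x].
  move=> /phi_neq0[si xi]; split=> //.
    by have := lip x (q i); lra.
  by have := lip (q i) x; rewrite metric_sym; lra.
have sep i j : sel i -> sel j -> i != j ->
    Num.min (rho (q i)) (rho (q j)) / 16 <= mdist (q i) (q j).
  wlog ij : i j / (i < j)%N => [hw si sj ne|si sj _].
    move: ne; rewrite neq_ltn => /orP[ij|ji].
      by apply: hw => //; rewrite ltn_eqF.
    by rewrite minC metric_sym; apply: hw => //; rewrite ltn_eqF.
  have [_ /(_ i ij si)] := (selP j).1 sj; rewrite metric_sym; apply: le_trans.
  by rewrite ler_pM2r// ge_min lexx.
(* Some [q n] lies within [rho x / 32] of [x]; if it was rejected, it lies within [rho (q k) / 16]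
   of a selected [q k]. Either way [x] is within an eighth of [rho] at the selected center, where
   its bump is 1. *)
have cover x : D x -> ~ A x -> exists k, phi k x = 1.
  move=> Dx nAx; have rx := rho0 Dx nAx; rewrite -/rho in rx.
  have [n xn] := qdense x (rho x / 32) Dx (divr_gt0 rx (ltr0n R 32)).
  have nAq : ~ A (q n).
    by move=> Aq; have := dist_to_le A0 x Aq; rewrite -/rho; lra.
  have rqx : rho (q n) <= 33 / 32 * rho x.
    by have := lip (q n) x; rewrite metric_sym; lra.
  have rxq : 31 / 32 * rho x <= rho (q n) by have := lip x (q n); lra.
  have [sn|nsn] := boolP (sel n).
    exists n; rewrite /phi sn bump_eq1//; last by lra.
    by rewrite divr_gt0// rho_pos.
  have [k sk qk] : exists2 k, sel k & mdist (q n) (q k) < rho (q k) / 16.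
    apply: contrapT => h; case/negP: nsn; apply/selP; split=> // k kn sk.
    by rewrite leNgt; apply/negP => nk; apply: h; exists k.
  exists k; have rk := rho_pos _ sk.
  rewrite /phi sk bump_eq1//; first by rewrite divr_gt0.
  have := metric_triangle x (q n) (q k); have := lip (q n) (q k).
  by lra.
(* Centers active at [x] are at least [4 / 5 * rho x / 16 = rho x / 20] apart, and at most
   [rho x]. *)
have [N hN] := pD (divr_gt0 (ltr01 : (0:R) < 1) (ltr0n R 20)).
have Jex x : exists s : seq nat, D x -> ~ A x ->
    [/\ uniq s, (size s <= N)%N & s =i (fun i => phi i x != 0)].
  have [[Dx nAx]|h] := pselect (D x /\ ~ A x); last first.
    by exists [::] => Dx nAx; case: h.
  have rx := rho0 Dx nAx; rewrite -/rho in rx.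
  have [|s [us sN sE]] :=
    @bounded_pred_seq _ (fun i => phi i x != 0) N; last by exists s.
  move=> s us /allP sx; rewrite -(size_map q).
  apply: (hN (rho x)) => //; first by move=> _ /mapP[i _ ->].
  rewrite pairwise_map.
  apply: (@sub_in_pairwise _ (mem s) (fun i j => i != j) _ _ s (allss s)).
    move=> i j is_ js ij /=.
    have [si xi li ui] := near _ _ (sx i is_).
    have [sj xj lj uj] := near _ _ (sx j js).
    have := sep _ _ si sj ij; have := metric_triangle (q i) x (q j).
    rewrite (metric_sym (q i) x).
    by case: (leP (rho (q i)) (rho (q j))) => _ *; apply/andP; split; lra.
  by rewrite -uniq_pairwise.
have [J JP] := choice Jex.
have alex i : exists a, sel i -> A a /\ mdist (q i) a <= 2 * rho (q i).
  have [si|] := boolP (sel i); last by exists b.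
  by have [a Aa ?] := dist_to_near A0 (rho_pos i si); exists a.
have [al alP] := choice alex.
exists sel, q, al, J, (max_increment phi), N, 40; split.
- move=> i si; have [_ nA] := conj si ((selP i).1 si).1.
  have [Aal _] := alP i si; split=> //.
  rewrite lt_neqAle mdist_ge0 andbT; apply/eqP => /esym/mdist_positivity qa.
  by apply: nA; rewrite qa.
- split=> //.
  + by move=> i x; exact: max_increment01.
  + move=> x Dx nAx; have [us sN sE] := JP x Dx nAx.
    split=> // [i /(max_increment_neq0 phi01)|].
      by rewrite sE.
    have [k pk] := cover x Dx nAx.
    by apply: (sum_max_increment phi01 us _ pk) => i pi; rewrite sE.
  + move=> i x y Dx nAx Dy nAy xy.
    have rx := rho0 Dx nAx; rewrite -/rho in rx xy *.
    have -> : 40 * mdist x y / rho x = 2 * (20 * mdist x y / rho x) by ring.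
    apply: max_increment_lip => // j.
    have ry : rho x / 2 <= rho y by have := lip x y; lra.
    have d0 := mdist_ge0 x y.
    (* A bump of radius [rho (q j) / 8] then has slope at most [20 / rho x]. The [2 / 5] is [4 / 5]
       halved, for the case where only [y] is in the support, since [rho y >= rho x / 2]. *)
    have main : sel j -> 2 / 5 * rho x <= rho (q j) ->
        `|phi j x - phi j y| <= 20 * mdist x y / rho x.
      move=> sj rj; rewrite /phi sj.
      have rq := rho_pos j sj.
      apply: le_trans (bump_lip _ _ _ (divr_gt0 rq (ltr0n R 8))) _.
      rewrite ler_pdivrMr ?divr_gt0//.
      have -> : 20 * mdist x y / rho x * (rho (q j) / 8) =
          5 / 2 * mdist x y * (rho (q j) / rho x) by field; rewrite gt_eqF.
      have : 2 / 5 <= rho (q j) / rho x by rewrite ler_pdivlMr.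
      by nra.
    have [px|px] := eqVneq (phi j x) 0; last first.
      by have [sj _ h _] := near _ _ px; apply: main => //; lra.
    have [py|py] := eqVneq (phi j y) 0; last first.
      by have [sj _ h _] := near _ _ py; apply: main => //; lra.
    by rewrite px py subrr normr0 divr_ge0 ?mulr_ge0// ltW.
- move=> i x Dx nAx; have [_ _ ->] := JP x Dx nAx => /near[si xi _ ui].
  have rx := rho0 Dx nAx; rewrite -/rho in rx *.
  by have [_ ?] := alP i si; split=> //; lra.
Qed.

End whitney.

(** * Spaces of Lipschitz functions *)

Ltac finite_functional_tac := repeat first
  [ exact: finite_functional_eval | exact: finite_functional0
  | apply: finite_functional_if | apply: finite_functionalN
  | apply: finite_functionalD | apply: finite_functionalZ
  | apply: finite_functionalZr
  | (apply: finite_functional_sum => ?) ].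

Section lip_spaces.
Context (R : realType).

(* Functions on a subset [D] are represented by functions on [Z] that vanish
   outside [D], so that equality of functions is plain equality. *)
Definition lip_space (Z : metricType R) (D : set Z) (b : Z) : fspace R.
Proof.
refine (@FSpace R Z (fun f L => [/\ 0 <= L,
  forall x y, D x -> D y -> `|f x - f y| <= L * mdist x y,
  forall x, ~ D x -> f x = 0 & f b = 0]) _ _ _ _ _).
- by move=> f L [].
- by move=> L L0; split=> // x y _ _; rewrite subrr normr0 mulr_ge0// mdist_ge0.
- move=> f g L K [L0 fL fD fb] [K0 gK gD gb]; split; first exact: addr_ge0.
  + move=> x y Dx Dy; rewrite opprD addrACA mulrDl.
    by rewrite (le_trans (ler_normD _ _))// lerD ?fL ?gK.
  + by move=> x Dx; rewrite fD// gD// addr0.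
  + by rewrite fb gb addr0.
- move=> f L [L0 fL fD fb]; split=> //.
  + by move=> x y Dx Dy; rewrite -opprD normrN fL.
  + by move=> x Dx; rewrite fD// oppr0.
  + by rewrite fb oppr0.
- move=> f L K [L0 fL fD fb] LK; split=> //; first exact: le_trans LK.
  move=> x y Dx Dy; rewrite (le_trans (fL x y Dx Dy))//.
  by rewrite ler_wpM2r// mdist_ge0.
Defined.

Definition scalars : fspace R.
Proof.
refine (@FSpace R unit (fun f L => `|f tt| <= L) _ _ _ _ _).
- by move=> f L; exact: le_trans.
- by move=> L; rewrite normr0.
- by move=> f g L K fL gK; rewrite (le_trans (ler_normD _ _))// lerD.
- by move=> f L; rewrite normrN.
- by move=> f L K; exact: le_trans.
Defined.

Lemma scalars_complemented (Z : metricType R) (D : set Z) b y :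
  D b -> D y -> y != b -> complemented scalars (lip_space D b).
Proof.
move=> Db Dy yb; have d0 : 0 < mdist y b by rewrite mdist_gt0.
exists (fun c x => if `[< D x >] then mdist x b * c tt else 0),
  (fun f _ => (mdist y b)^-1 * f y); split.
- split=> [x|]; first by finite_functional_tac.
  exists 1 => // c L /= cL; have L0 : 0 <= L := le_trans (normr_ge0 _) cL.
  rewrite mul1r; split=> //.
  + move=> u v Du Dv; rewrite !asboolT// -mulrBl normrM mulrC.
    apply: ler_pM => //; rewrite ler_norml.
    have h1 := metric_triangle u v b; have h2 := metric_triangle v u b.
    by rewrite (metric_sym v u) in h2; apply/andP; split; lra.
  + by move=> x Dx; rewrite asboolF.
  + by rewrite asboolT// mdistxx mul0r.
- split=> [x|]; first by finite_functional_tac.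
  exists 1 => // f L [L0 fL fD fb] /=; have := fL y b Dy Db.
  rewrite fb subr0 mul1r normrM ger0_norm ?invr_ge0 ?mdist_ge0// => h.
  by rewrite mulrC ler_pdivrMr.
- move=> c L _; apply/funext => -[]; rewrite asboolT//.
  by rewrite mulKf// gt_eqF.
Qed.

Lemma lip_space_base (Z : metricType R) (D : set Z) b b' :
  D b -> D b' -> fiso (lip_space D b) (lip_space D b').
Proof.
pose T c (f : Z -> R) x := if `[< D x >] then f x - f c else 0.
have bT a c : D c -> @bounded_op R (lip_space D a) (lip_space D c) (T c).
  move=> Dc; split=> [x|]; first by rewrite /T; finite_functional_tac.
  exists 1 => // f L [L0 fL fD fa]; rewrite mul1r; split=> //.
  - move=> u v Du Dv; rewrite /T !asboolT//.
    have -> : f u - f c - (f v - f c) = f u - f v by ring.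
    exact: fL.
  - by move=> x Dx; rewrite /T asboolF.
  - by rewrite /T asboolT// subrr.
have TT a c f L : D a -> D c -> @nle R (lip_space D a) f L -> T a (T c f) = f.
  move=> Da Dc [L0 fL fD fa]; apply/funext => x; rewrite /T.
  have [Dx|nDx] := pselect (D x); last by rewrite asboolF// fD.
  by rewrite !asboolT// fa; ring.
move=> Db Db'; exists (T b'), (T b); split; [exact: bT|exact: bT| |].
  by move=> f L fL; apply: TT fL.
by move=> f L fL; apply: TT fL.
Qed.

Lemma lip_space_bilip (Z Y : metricType R) (D : set Z) (E : set Y) b
    (phi : Z -> Y) (psi : Y -> Z) (C : R) :
  D b -> 0 <= C ->
  (forall x, D x -> E (phi x)) -> (forall y, E y -> D (psi y)) ->
  (forall x, D x -> psi (phi x) = x) -> (forall y, E y -> phi (psi y) = y) ->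
  (forall x y, D x -> D y -> mdist (phi x) (phi y) <= C * mdist x y) ->
  (forall x y, E x -> E y -> mdist (psi x) (psi y) <= C * mdist x y) ->
  fiso (lip_space D b) (lip_space E (phi b)).
Proof.
move=> Db C0 DE ED phiK psiK phiC psiC.
exists (fun f y => if `[< E y >] then f (psi y) else 0),
  (fun g x => if `[< D x >] then g (phi x) else 0); split.
- split=> [x|]; first by finite_functional_tac.
  exists C => // f L [L0 fL fD fb]; split; first exact: mulr_ge0.
  + move=> u v Eu Ev; rewrite !asboolT//.
    rewrite (le_trans (fL _ _ (ED _ Eu) (ED _ Ev)))//.
    by rewrite [C * L]mulrC -mulrA ler_wpM2l// psiC.
  + by move=> x Ex; rewrite asboolF.
  + by rewrite asboolT ?phiK//; exact: DE.
- split=> [x|]; first by finite_functional_tac.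
  exists C => // f L [L0 fL fD fb]; split; first exact: mulr_ge0.
  + move=> u v Du Dv; rewrite !asboolT//.
    rewrite (le_trans (fL _ _ (DE _ Du) (DE _ Dv)))//.
    by rewrite [C * L]mulrC -mulrA ler_wpM2l// phiC.
  + by move=> x Dx; rewrite asboolF.
  + by rewrite asboolT.
- move=> f L [L0 fL fD fb]; apply/funext => x.
  have [Dx|nDx] := pselect (D x); last by rewrite asboolF// fD.
  by rewrite !asboolT ?phiK//; exact: DE.
- move=> f L [L0 fL fD fb]; apply/funext => x.
  have [Ex|nEx] := pselect (E x); last by rewrite asboolF// fD.
  by rewrite !asboolT ?psiK//; exact: ED.
Qed.

Section decomposition.
Context (Z : metricType R) (D A S : set Z) (a0 s0 : Z).
Hypothesis Aa0 : A a0.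
Hypothesis Ss0 : S s0.
Hypothesis DAS : D = A `|` S.
Hypothesis rho0 : forall x, D x -> ~ A x -> 0 < dist_to A x.
Hypothesis pD : packing D.

(* On a Whitney piece around [p i], with [al i] a nearly closest point of [A],
   [f x] is [f (al i) + (f x - f (p i)) + (f (p i) - f (al i))]: a value on [A],
   a difference on [S], and a scalar of size [mdist (p i) (al i)]. *)
Lemma lip_space_union_op :
  let W := fsum (lip_space A a0) (fsum (lip_space S s0) (flinf nat scalars)) in
  exists T U, [/\ @bounded_op R (lip_space D a0) W T,
    @bounded_op R W (lip_space D a0) U,
    forall f L, @nle R (lip_space D a0) f L -> U (T f) = f &
    forall F a, A a -> U F a = F (inl a)].
Proof.
move=> W.
have A0 : A !=set0 by exists a0.
have AD : A `<=` D by rewrite DAS; exact: subsetUl.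
have SD : S `<=` D by rewrite DAS; exact: subsetUr.
have DS x : D x -> ~ A x -> S x by rewrite DAS => -[].
have [sel [p [al [J [psi [N [K [selP pJ near]]]]]]]] :=
  whitney_partition A0 AD rho0 pD.
pose r i := mdist (p i) (al i).
pose v (F : carrier W -> R) i x : R := F (inl (al i)) + F (inr (inl x))
  - F (inr (inl (p i))) + r i * F (inr (inr (i, tt))).
pose U (F : carrier W -> R) (x : Z) : R := if `[< D x >] then
  (if `[< A x >] then F (inl x) else \sum_(i <- J x) psi i x * v F i x) else 0.
(* Subtracting [f s0] makes the coordinate on [S] vanish at its base point; [v] uses only its
   differences. *)
pose T (f : Z -> R) (s : carrier W) : R := match s with
  | inl a => if `[< A a >] then f a else 0
  | inr (inl x) => if `[< S x >] then f x - f s0 else 0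
  | inr (inr (i, _)) => if sel i then (r i)^-1 * (f (p i) - f (al i)) else 0
  end.
have UA F a : A a -> U F a = F (inl a).
  by move=> Aa; rewrite /U !asboolT//; exact: AD.
have [K0 psi01 pJ' psiL] := pJ.
exists T, U; split=> //.
- split=> [[a|[x|[i t]]]|]; [by rewrite /T; finite_functional_tac..|].
  exists 1 => // f L [L0 fL fD fa]; rewrite mul1r; split; [|split].
  + split=> //= [x y Ax Ay|x Ax|]; first by rewrite !asboolT// fL//; exact: AD.
      by rewrite asboolF.
    by rewrite asboolT.
  + split=> //= [x y Sx Sy|x Sx|]; last by rewrite asboolT// subrr.
      rewrite !asboolT//.
      have -> : f x - f s0 - (f y - f s0) = f x - f y by ring.
      by apply: fL; exact: SD.
    by rewrite asboolF.
  + split=> // i /=; case: ifPn => si; last by rewrite normr0.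
    have [Dp nAp Aal r0] := selP i si.
    rewrite normrM ger0_norm ?invr_ge0 ?mdist_ge0// mulrC ler_pdivrMr//.
    by apply: fL => //; exact: AD.
- split=> [x|]; first by rewrite /U /v; finite_functional_tac.
  (* The 11 is [6 + 1 + 4]: in units of [mdist z a], the bounds on [mdist (al i) a], [mdist z (p i)]
     and [r i], which control the three parts of [v F i z - F (inl a)]. *)
  pose C := (2 * N%:R * (1 + 3 * K) + 9) * 11.
  have C0 : 0 <= C.
    by rewrite /C mulr_ge0// addr_ge0// mulr_ge0 ?mulr_ge0// addr_ge0//
      mulr_ge0.
  exists C => // F L [[L0 hL hA ha] [[_ gL gS gs] [_ cL]]].
  rewrite /= in hL hA ha gL gS gs cL.
  split; first exact: mulr_ge0.
  + have UE x : D x -> U F x = glue A J psi (F \o inl) (v F) x.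
      by move=> Dx; rewrite /U asboolT.
    move=> x y Dx Dy; rewrite !UE//.
    have -> : C * L * mdist x y =
      (2 * N%:R * (1 + 3 * K) + 9) * (11 * L) * mdist x y by rewrite /C; ring.
    apply: (glue_lipschitz A0 rho0 pJ) => //; first exact: mulr_ge0.
    * move=> a b Aa Ab /=; rewrite (le_trans (hL a b Aa Ab))//.
      by rewrite ler_wpM2r ?mdist_ge0//; lra.
    * move=> i z a Dz nAz iJ _ Aa; have [si zp pal] := near i z Dz nAz iJ.
      have [Dp nAp Aal r0] := selP i si.
      have h1 := hL _ _ Aal Aa.
      have h2 := gL z (p i) (DS z Dz nAz) (DS _ Dp nAp).
      have h3 : `|r i * F (inr (inr (i, tt)))| <= L * r i.
        by rewrite normrM ger0_norm ?mdist_ge0// mulrC ler_wpM2r ?mdist_ge0//.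
      have -> : v F i z - (F \o inl) a = (F (inl (al i)) - F (inl a)) +
         (F (inr (inl z)) - F (inr (inl (p i)))) + r i * F (inr (inr (i, tt))).
        by rewrite /v /=; ring.
      apply: (le_trans (ler_normD _ _)).
      apply: (le_trans (lerD (le_trans (ler_normD _ _) (lerD h1 h2)) h3)).
      rewrite -!mulrDr [11 * L]mulrC -mulrA ler_wpM2l//.
      have za := dist_to_le A0 z Aa.
      have := metric_triangle (al i) (p i) a; have := metric_triangle (p i) z a.
      rewrite (metric_sym (al i) (p i)) (metric_sym (p i) z) /r.
      by rewrite /r in r0; lra.
    * move=> i z w Dz nAz Dw nAw _ _.
      have -> : v F i z - v F i w = F (inr (inl z)) - F (inr (inl w)).
        by rewrite /v; ring.
      apply: (le_trans (gL _ _ (DS z Dz nAz) (DS w Dw nAw))).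
      by rewrite ler_wpM2r ?mdist_ge0//; lra.
  + by move=> x nDx; rewrite /U asboolF.
  + by rewrite UA.
- move=> f L [L0 fL fD fa]; apply/funext => x.
  have [Dx|nDx] := pselect (D x); last by rewrite /U asboolF// fD.
  have [Ax|nAx] := pselect (A x); first by rewrite UA//= asboolT.
  have [_ _ _ s1] := pJ' x Dx nAx.
  rewrite /U asboolT// asboolF// -[RHS]mul1r -s1 mulr_suml.
  apply: eq_big_seq => i iJ; congr (_ * _).
  have [si _ _] := near i x Dx nAx iJ; have [Dp nAp Aal r0] := selP i si.
  rewrite /v /= si !asboolT//; [|exact: DS..].
  by rewrite mulrA mulfV ?gt_eqF//; ring.
Qed.

End decomposition.

Lemma lip_space_union (Z : metricType R) (A S : set Z) a0 s0 :
  A a0 -> S s0 -> (forall x, S x -> ~ A x -> 0 < dist_to A x) ->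
  packing (A `|` S) ->
  complemented (lip_space (A `|` S) a0)
    (fsum (lip_space A a0) (fsum (lip_space S s0) (flinf nat scalars))).
Proof.
move=> Aa0 Ss0 rho0 pD.
have [|T [U [bT bU UT _]]] := lip_space_union_op Aa0 Ss0 erefl _ pD.
  by move=> x [//|Sx nAx]; exact: rho0.
by exists T, U.
Qed.

(** The decomposition above with [S := D], fed with [f] on [A] and zero in the other summands. *)
Lemma lip_space_extension (Z : metricType R) (D A : set Z) a0 :
  A a0 -> A `<=` D -> (forall x, D x -> ~ A x -> 0 < dist_to A x) ->
  packing D ->
  exists2 T, @bounded_op R (lip_space A a0) (lip_space D a0) T &
    forall f x, A x -> T f x = f x.
Proof.
move=> Aa0 AD rho0 pD.
have [T [U [_ bU _ UA]]] :=
  lip_space_union_op Aa0 (AD _ Aa0) (esym (setUidr AD)) rho0 pD.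
exists (fun f => U (fun s => if s is inl x then f x else 0)).
  apply: (bounded_op_comp (W := fsum (lip_space A a0) (fsum (lip_space D a0)
    (flinf nat scalars))) _ bU); split; first by case=> s;
      finite_functional_tac.
  exists 1 => // f L fL; rewrite mul1r; split=> //.
  exact/nle0/(nle_ge0 fL).
by move=> f x Ax; rewrite UA.
Qed.

Lemma bounded_op_restriction (Z : metricType R) (D A : set Z) a0 :
  A a0 -> A `<=` D -> @bounded_op R (lip_space D a0) (lip_space A a0)
    (fun f x => if `[< A x >] then f x else 0).
Proof.
move=> Aa0 AD; split=> [x|]; first by finite_functional_tac.
exists 1 => // f L [L0 fL fD fa]; rewrite mul1r; split=> //.
- by move=> x y Ax Ay; rewrite !asboolT// fL//; exact: AD.
- by move=> x nAx; rewrite asboolF.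
- by rewrite asboolT.
Qed.

Lemma lip_space_complemented (Z : metricType R) (D A : set Z) a0 :
  A a0 -> A `<=` D -> (forall x, D x -> ~ A x -> 0 < dist_to A x) ->
  packing D -> complemented (lip_space A a0) (lip_space D a0).
Proof.
move=> Aa0 AD rho0 pD; have [T bT TE] := lip_space_extension Aa0 AD rho0 pD.
exists T, (fun f x => if `[< A x >] then f x else 0); split=> //.
  exact: bounded_op_restriction.
move=> f L [L0 fL fA fa]; apply/funext => x.
by case: asboolP => Ax; [rewrite TE|rewrite fA].
Qed.

End lip_spaces.

(** * Annuli in a self-similar space *)

Section scalings.
Context (R : realType).

Lemma exprz_bracket (a t : R) : 1 < a -> 0 < t ->
  exists n : int, 1 <= a ^ n * t < a.
Proof.
move=> a1 t0; have a0 : 0 < a by exact: lt_trans a1.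
have la : 0 < ln a by rewrite ln_gt0.
pose m := Num.floor (ln t / ln a).
have /andP[m1 m2] : m%:~R <= ln t / ln a < (m + 1)%:~R by exact: floor_itv.
have expE (n : int) : a ^ n = expR (n%:~R * ln a).
  by rewrite -powR_intmul ?ltW// /powR gt_eqF.
have tE : t = expR (ln t) by rewrite lnK.
exists (- m); rewrite expE [X in _ * X]tE -expRD rmorphN/= mulNr.
rewrite -[X in X <= _]expR0 ler_expR -[X in _ < X](lnK a0) ltr_expR.
rewrite ler_pdivlMr// in m1; rewrite ltr_pdivrMr// rmorphD/= mulrDl mul1r in m2.
by apply/andP; split; lra.
Qed.

Lemma self_similar_scaling (M : metricType R) (x0 : M) : self_similar x0 ->
  exists (a : R) (s : int -> M -> M), [/\ 1 < a,
    forall n x y, mdist (s n x) (s n y) = a ^ n * mdist x y,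
    forall n x, s n (s (- n) x) = x & forall n, s n x0 = x0].
Proof.
move=> [a [f [a1 [g fK gK] fd f0]]].
have a0 : 0 < a by exact: lt_trans a1.
have gd x y : mdist (g x) (g y) = a^-1 * mdist x y.
  by rewrite -[in RHS](gK x) -[in RHS](gK y) fd mulKf// gt_eqF.
have g0 : g x0 = x0 by rewrite -[in LHS]f0 fK.
(* [Negz k] is [-(k + 1)], hence the extra iterate. *)
exists a, (fun n => match n with Posz k => iter k f | Negz k => iter k.+1 g
  end).
have itd (h : M -> M) c : (forall x y, mdist (h x) (h y) = c * mdist x y) ->
    forall k x y, mdist (iter k h x) (iter k h y) = c ^+ k * mdist x y.
  move=> hd; elim=> [|k IH] x y /=; first by rewrite mul1r.
  by rewrite hd IH exprS mulrA.
have itK (h h' : M -> M) k : cancel h h' -> cancel (iter k h) (iter k h').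
  by move=> hK; elim: k => // k IH x; rewrite iterSr /= hK IH.
have it0 (h : M -> M) k : h x0 = x0 -> iter k h x0 = x0.
  by move=> h0; elim: k => //= k ->.
split=> //.
- case=> k x y; first exact: (itd _ _ fd).
  by rewrite (itd _ _ gd) exprVn.
- by case=> [[|k]|k] x //=; [apply: (itK g f k.+1)|apply: (itK f g k.+1)].
- by case=> k; exact: it0.
Qed.

End scalings.

Section annuli.
Context (R : realType) (M : metricType R) (x0 : M) (a : R).
Hypothesis a1 : 1 < a.

Let a0 : 0 < a. Proof. exact: lt_trans a1. Qed.
Let an0 (n : int) : 0 < a ^ n. Proof. exact: exprz_gt0. Qed.

Definition annulus_gap : R := (1 - a^-1) / 3.
Let eta := annulus_gap.

Let ai : 0 < a^-1 < 1.
Proof. by rewrite invr_gt0 a0 invf_lt1. Qed.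

Lemma annulus_gap_gt0 : 0 < eta.
Proof. by have := ai; rewrite /eta /annulus_gap; lra. Qed.

Let aV : a * a^-1 = 1. Proof. by rewrite mulfV// gt_eqF. Qed.

(** The reason for the choice of [eta]: the plateau of one scale, up to [(1 + eta) * t0], ends no
    later than the ramp of the next one begins. The two sides differ by
    [(a - 1) * (1 - a^-1) / 3]. *)
Let a_eta : 1 + eta <= a * (1 - 2 * eta).
Proof.
have := ai; rewrite /eta /annulus_gap => /andP[i0 i1].
have -> : a * (1 - 2 * ((1 - a^-1) / 3)) = (a + 2 * (a * a^-1)) / 3 by field;
  rewrite gt_eqF.
have h : 0 <= (a - 1) * (1 - a^-1) by rewrite mulr_ge0// subr_ge0 ltW.
have e : (a - 1) * (1 - a^-1) = a - a * a^-1 - 1 + a^-1 by ring.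
by move: h; rewrite e aV; lra.
Qed.

Lemma dist_to_set1 (Z : metricType R) (b x : Z) : dist_to [set b] x = mdist x b.
Proof. by rewrite /dist_to image_set1 inf1. Qed.

Section partition.
Variable t0 : R.
Hypothesis t0_gt0 : 0 < t0.

Let ramp (r : R) : R :=
  Num.max 0 (Num.min 1 ((r - (1 - 2 * eta) * t0) / (eta * t0))).

Let et0 : 0 < eta * t0. Proof. exact: mulr_gt0 annulus_gap_gt0 _. Qed.

Let ramp01 r : 0 <= ramp r <= 1.
Proof. by rewrite /ramp le_max lexx/= ge_max ler01/= ge_min lexx. Qed.

Let ramp0 r : r <= (1 - 2 * eta) * t0 -> ramp r = 0.
Proof.
move=> h; rewrite /ramp max_l// ge_min; apply/orP; right.
by rewrite pmulr_lle0 ?invr_gt0// subr_le0.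
Qed.

Let ramp1 r : (1 - eta) * t0 <= r -> ramp r = 1.
Proof.
move=> h; rewrite /ramp min_l ?max_r// ler_pdivlMr//.
by rewrite mul1r; lra.
Qed.

Let ramp_lip r r' : `|ramp r - ramp r'| <= `|r - r'| / (eta * t0).
Proof.
set c := (1 - 2 * eta) * t0.
have : `|(r - c) / (eta * t0) - (r' - c) / (eta * t0)| <= `|r - r'| / (eta *
  t0).
  rewrite -mulrBl normrM [`|(eta * t0)^-1|]ger0_norm ?invr_ge0 ?(ltW et0)//.
  by have -> : r - c - (r' - c) = r - r' by ring.
rewrite /ramp -/c; set B := `|r - r'| / _; have : 0 <= B.
  by rewrite divr_ge0// ltW.
rewrite /Num.max /Num.min !ler_norml => B0 /andP[h1 h2].
by apply/andP; split; repeat case: ifPn; rewrite -?leNgt; lra.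
Qed.

Let ramp_mono r r' : r <= r' -> ramp r <= ramp r'.
Proof.
move=> rr; have : (r - (1 - 2 * eta) * t0) / (eta * t0) <=
    (r' - (1 - 2 * eta) * t0) / (eta * t0).
  by rewrite ler_wpM2r ?invr_ge0 ?(ltW et0)// lerD2r.
rewrite /ramp /Num.max /Num.min.
by repeat case: ifPn; rewrite -?leNgt; lra.
Qed.

Let psi (n : int) (x : M) : R :=
  ramp (a ^ n * mdist x x0) - ramp (a ^ (n - 1) * mdist x x0).

Let aS (n : int) : a * a ^ (n - 1) = a ^ n.
Proof. by rewrite -[X in X * _]expr1z -expfzDr ?gt_eqF// addrC subrK. Qed.

Let leA (m n : int) x : m <= n -> a ^ m * mdist x x0 <= a ^ n * mdist x x0.
Proof.
by move=> mn; rewrite ler_wpM2r ?mdist_ge0//; apply: ler_weXz2l => //;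
  exact: ltW.
Qed.

Let psi_neq0 n x : psi n x != 0 ->
  (1 - 2 * eta) * t0 < a ^ n * mdist x x0 < a * t0.
Proof.
move=> h; have eta0 : 0 < eta := annulus_gap_gt0; apply/andP; split.
  rewrite ltNge; apply/negP => le; move: h; rewrite /psi !ramp0 ?subrr ?eqxx//.
  by apply: le_trans le; apply: leA; rewrite gerBl.
rewrite ltNge; apply/negP => le; move: h.
have le' : (1 - eta) * t0 <= a ^ (n - 1) * mdist x x0.
  move: le; rewrite -aS -mulrA ler_pM2l// => le; apply: le_trans le.
  by rewrite ler_piMl ?(ltW t0_gt0)//; lra.
rewrite /psi !ramp1 ?subrr ?eqxx//.
by apply: (le_trans le'); apply: leA; rewrite gerBl.
Qed.

(** The weights are differences of one ramp at the scales [a ^ n] and [a ^ (n - 1)], so they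
    telescope to 1. The ramp climbs from [(1 - 2 * eta) * t0] to [(1 - eta) * t0], which leaves a
    plateau around [t0] where [psi n] is 1 and all other weights vanish. *)
Lemma annuli_partition : exists (J : M -> seq int) (psi : int -> M -> R)
    (N : nat) (K : R),
  [/\ unity_partition setT [set x0] J psi N K,
      forall n x, psi n x != 0 -> a ^ n * mdist x x0 < a * t0 &
      forall n x, (1 - eta) * t0 <= a ^ n * mdist x x0 <= (1 + eta) * t0 ->
        forall m, psi m x = (m == n)%:R].
Proof.
have eta0 : 0 < eta := annulus_gap_gt0.
have eta1 : eta < 1 / 3 by have := ai; rewrite /eta /annulus_gap; lra.
(* [n0 x] is the scale bringing the distance into one period that starts at the foot of the ramp; by
   [a_eta] only [n0 x] and [n0 x + 1] can be active. At [x0] the value 0 is a default. *)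
have n0ex x : exists n : int, x <> x0 ->
    (1 - 2 * eta) * t0 <= a ^ n * mdist x x0 < a * ((1 - 2 * eta) * t0).
  have [->|/eqP xx0] := pselect (x = x0); first by exists 0.
  have dx : 0 < mdist x x0 by rewrite mdist_gt0.
  have c0 : 0 < (1 - 2 * eta) * t0 by rewrite mulr_gt0//; lra.
  have [n /andP[n1 n2]] := exprz_bracket a1 (divr_gt0 dx c0).
  exists n => _; rewrite mulrA ler_pdivlMr// mul1r in n1.
  by rewrite mulrA ltr_pdivrMr// in n2; rewrite n1.
have [n0 n0P] := choice n0ex.
exists (fun x => [:: n0 x; n0 x + 1]), psi, 2%N, (4 * a / eta); split.
- split.
  + apply: divr_ge0; [apply: mulr_ge0 => //|]; exact: ltW.
  + move=> n x; have /andP[_ r1] := ramp01 (a ^ n * mdist x x0).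
    have /andP[r0 _] := ramp01 (a ^ (n - 1) * mdist x x0).
    have : ramp (a ^ (n - 1) * mdist x x0) <= ramp (a ^ n * mdist x x0).
      by apply/ramp_mono/leA; rewrite gerBl.
    by rewrite /psi => ?; apply/andP; split; lra.
  + move=> x _ /= xx0; have /andP[n1 n2] := n0P x xx0; split=> //.
    * by rewrite /= inE andbT -subr_eq0 opprD addNKr oppr_eq0.
    * move=> n /psi_neq0/andP[h1 h2].
      rewrite !inE; apply/orP.
      have [lt|] := ltP n (n0 x).
        have : a ^ n * mdist x x0 <= a ^ (n0 x - 1) * mdist x x0.
          by apply: leA; rewrite lerBrDr lezD1.
        move: n2; rewrite -aS -mulrA ltr_pM2l//.
        by lra.
      rewrite le_eqVlt => /orP[/eqP ->|lt]; first by left.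
      right; rewrite eq_le lezD1 lt andbT.
      rewrite leNgt; apply/negP => lt'.
      have : a ^ (n0 x + 2) * mdist x x0 <= a ^ n * mdist x x0.
        by apply: leA; rewrite -lezD1 -addrA in lt'.
      have e1 : a ^ (n0 x + 2) = a * (a * a ^ n0 x).
        have := aS (n0 x + 2); have := aS (n0 x + 1).
        have -> : n0 x + 1 - 1 = n0 x by rewrite addrK.
        have -> : n0 x + 2 - 1 = n0 x + 1 by rewrite -addrA.
        by move=> -> ->.
      rewrite e1 -!mulrA => h.
      have : a * (a * (a ^ n0 x * mdist x x0)) < a * t0 by exact: le_lt_trans
        h h2.
      rewrite ltr_pM2l// => h3.
      have : a * ((1 - 2 * eta) * t0) <= a * (a ^ n0 x * mdist x x0).
        by rewrite ler_pM2l.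
      by have := a_eta; nra.
    * rewrite big_cons big_seq1 /psi;
      have -> : n0 x + 1 - 1 = n0 x by rewrite addrK.
      rewrite [ramp (a ^ (n0 x + 1) * _)]ramp1; last first.
        have := aS (n0 x + 1); have -> : n0 x + 1 - 1 = n0 x by rewrite addrK.
        move=> <-; rewrite -mulrA.
        have : a * ((1 - 2 * eta) * t0) <= a * (a ^ n0 x * mdist x x0).
          by rewrite ler_pM2l.
        by have := a_eta; nra.
      rewrite [ramp (a ^ (n0 x - 1) * _)]ramp0; first by ring.
      by move: n2; rewrite -aS -mulrA ltr_pM2l// => /ltW.
  + move=> n x y _ /= xx0 _ /= yx0; rewrite dist_to_set1 => xy.
    have dx : 0 < mdist x x0 by rewrite mdist_gt0; apply/eqP.
    have d0 := mdist_ge0 x y.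
    (* A ramp has slope at most [1 / (eta * t0)], so at such a scale at most
       [2 * a / (eta * mdist x x0)] as a function of the point; two ramps make the [4 * a / eta].
       The slack 2 covers the case where only [y] is in the support. *)
    have main : a ^ n * mdist x x0 <= 2 * a * t0 ->
        `|psi n x - psi n y| <= 4 * a / eta * mdist x y / mdist x x0.
      move=> an.
      have dxy : `|mdist x x0 - mdist y x0| <= mdist x y.
        rewrite ler_norml; have h1 := metric_triangle x y x0.
        have h2 := metric_triangle y x x0.
        by rewrite (metric_sym y x) in h2; apply/andP; split; lra.
      have rl m : m <= n -> `|ramp (a ^ m * mdist x x0) -
          ramp (a ^ m * mdist y x0)| <= 2 * a / eta * mdist x y / mdist x x0.
        move=> mn; apply: (le_trans (ramp_lip _ _)).
        rewrite -mulrBr normrM [`|a ^ m|]gtr0_norm// ler_pdivrMr//.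
        have -> : 2 * a / eta * mdist x y / mdist x x0 * (eta * t0) =
           2 * a * t0 / mdist x x0 * mdist x y.
          by field; rewrite !gt_eqF.
        apply: ler_pM => //; first exact: ltW.
        by rewrite ler_pdivlMr// (le_trans (leA _ mn)).
      have -> : psi n x - psi n y =
        (ramp (a ^ n * mdist x x0) - ramp (a ^ n * mdist y x0)) -
        (ramp (a ^ (n - 1) * mdist x x0) - ramp (a ^ (n - 1) * mdist y x0)).
        by rewrite /psi; ring.
      rewrite (le_trans (ler_normB _ _))//.
      have h1 := rl n (lexx _).
      have h2 : n - 1 <= n by rewrite gerBl.
      apply: (le_trans (lerD h1 (rl _ h2))).
      have -> : 4 * a / eta * mdist x y / mdist x x0 =
        2 * a / eta * mdist x y / mdist x x0 +
        2 * a / eta * mdist x y / mdist x x0 by field; rewrite !gt_eqF.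
      exact: lexx.
    have [px|/psi_neq0/andP[_ px]] := eqVneq (psi n x) 0; last first.
      by apply: main; have : 0 < a * t0 := mulr_gt0 a0 t0_gt0; lra.
    have [py|/psi_neq0/andP[_ py]] := eqVneq (psi n y) 0; last first.
      apply: main; have : mdist x x0 <= 2 * mdist y x0.
        by have := metric_triangle x y x0; lra.
      by move=> h; have := ler_wpM2l (ltW (an0 n)) h; lra.
    rewrite px py subrr normr0; apply: divr_ge0; last exact: ltW.
    apply: mulr_ge0 => //.
    by apply: divr_ge0; [apply: mulr_ge0 => //|]; exact: ltW.
- by move=> n x /psi_neq0/andP[].
- move=> n x /andP[h1 h2] m.
  have h3 : a ^ (n - 1) * mdist x x0 <= (1 - 2 * eta) * t0.
    rewrite -(ler_pM2l a0) mulrA aS mulrA; apply: (le_trans h2).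
    by rewrite ler_pM2r.
  case: eqVneq => [->|mn]; first by rewrite /psi ramp1// ramp0// subr0.
  rewrite /psi; have [lt|le] := ltP m n.
    have h4 : a ^ m * mdist x x0 <= (1 - 2 * eta) * t0.
      by apply: le_trans h3; apply: leA; rewrite lerBrDr lezD1.
    rewrite !ramp0 ?subrr//.
    by apply: le_trans h4; apply: leA; rewrite gerBl.
  have h4 : (1 - eta) * t0 <= a ^ (m - 1) * mdist x x0.
    apply: (le_trans h1); apply: leA.
    by rewrite lerBrDr lezD1 lt_neqAle eq_sym mn.
  rewrite !ramp1 ?subrr//.
  by apply: (le_trans h4); apply: leA; rewrite gerBl.
Qed.

End partition.
End annuli.

Section annuli_operators.
Context (R : realType) (M : metricType R) (x0 : M) (a : R) (s : int -> M -> M).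
Hypothesis a1 : 1 < a.
Hypothesis sd : forall n x y, mdist (s n x) (s n y) = a ^ n * mdist x y.
Hypothesis sK : forall n x, s n (s (- n) x) = x.
Hypothesis s0 : forall n, s n x0 = x0.
Hypothesis pM : packing [set: M].

Let a0 : 0 < a. Proof. exact: lt_trans a1. Qed.
Let an0 (n : int) : 0 < a ^ n. Proof. exact: exprz_gt0. Qed.
Let aK (n : int) : a ^ (- n) * a ^ n = 1.
Proof. by rewrite -expfzDr ?gt_eqF// addNr. Qed.
Let eta := annulus_gap a.
Let full := lip_space [set: M] x0.
Let cball (r : R) : set M := [set x | mdist x x0 <= r].

Let cball0 r : 0 < r -> cball r x0.
Proof. by move=> r0; rewrite /cball/= mdistxx ltW. Qed.

Let cball_extension (D : set M) r : 0 < r -> cball r `<=` D ->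
  exists2 T, @bounded_op R (lip_space (cball r) x0) (lip_space D x0) T &
    forall f x, cball r x -> T f x = f x.
Proof.
move=> r0 rD; apply: lip_space_extension => //; first exact: cball0.
  move=> x _ /negP; rewrite -ltNge => rx.
  apply: (@lt_le_trans _ _ (mdist x x0 - r)); first by rewrite subr_gt0.
  apply: dist_to_ge; first by exists x0; exact: cball0.
  by move=> y yr; rewrite lerBlDr (le_trans (metric_triangle x y x0))// lerD2l.
exact: packing_sub pM.
Qed.

(** [G] assembles one function from a family indexed by scales; the factor [a ^ (- n)] cancels the
    dilation [s n], so all summands share a Lipschitz bound. The last clause lets a single
    [F (n, _)] be read back on its plateau. *)
Lemma annuli_glue (t0 : R) : 0 < t0 ->
  exists (G : (int * M -> R) -> M -> R) (J : M -> seq int)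
    (psi : int -> M -> R),
  [/\ @bounded_op R (flinf int full) full G /\ (forall F, G F x0 = 0),
      forall F x, x != x0 ->
        G F x = \sum_(n <- J x) psi n x * (a ^ (- n) * F (n, s n x)),
      forall x, x != x0 -> \sum_(n <- J x) psi n x = 1,
      forall n x, psi n x != 0 -> a ^ n * mdist x x0 < a * t0 &
      forall n x F, (1 - eta) * t0 <= a ^ n * mdist x x0 <= (1 + eta) * t0 ->
        G F x = a ^ (- n) * F (n, s n x)].
Proof.
move=> t0_gt0.
have [J [psi [N [K [pJ supp plateau]]]]] := annuli_partition x0 a1 t0_gt0.
have [K0 psi01 pJ' psiL] := pJ.
pose v (F : int * M -> R) n x := a ^ (- n) * F (n, s n x).
pose G F x := if `[< [set x0] x >] then 0 else
  \sum_(n <- J x) psi n x * v F n x.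
have GE F x : x != x0 -> G F x = \sum_(n <- J x) psi n x * v F n x.
  by move=> /eqP xx0; rewrite /G asboolF.
have S0 : [set x0] !=set0 by exists x0.
have rho0 x : [set: M] x -> ~ [set x0] x -> 0 < dist_to [set x0] x.
  by move=> _ /eqP xx0; rewrite dist_to_set1 mdist_gt0.
have dF F L n x y : @nle R (flinf int full) F L ->
    `|v F n x - v F n y| <= L * mdist x y.
  move=> [L0 /(_ n)[_ FL _ _]]; rewrite -mulrBr normrM gtr0_norm//.
  apply: (le_trans (ler_wpM2l (ltW (an0 (- n))) (FL (s n x) (s n y) I I))).
  by rewrite sd mulrCA [a ^ (- n) * _]mulrA aK mul1r.
have v0 F L n : @nle R (flinf int full) F L -> v F n x0 = 0.
  by move=> [L0 /(_ n)[_ _ _ F0]]; rewrite /v s0 F0 mulr0.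
exists G, J, psi; split=> //; first split.
- split=> [x|]; first by rewrite /G /v; finite_functional_tac.
  exists (2 * N%:R * (1 + 3 * K) + 9) => [|F L FL].
    by rewrite addr_ge0// mulr_ge0 ?mulr_ge0// addr_ge0// mulr_ge0.
  have L0 : 0 <= L by case: FL.
  split.
  + rewrite mulr_ge0// addr_ge0// mulr_ge0 ?mulr_ge0// addr_ge0// mulr_ge0//.
  + move=> x y _ _.
    apply: (glue_lipschitz S0 rho0 pJ (h := fun=> 0) (v := v F)) => //.
    * by move=> *; rewrite subrr normr0 mulr_ge0// mdist_ge0.
    * move=> n z b _ _ _ _ ->; rewrite subr0 -[v F n z]subr0 -(v0 F L n FL).
      exact: dF.
    * by move=> n z w *; exact: dF.
  + by move=> x [].
  + by rewrite /G asboolT.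
- by move=> F; rewrite /G asboolT.
- by move=> x /eqP xx0; have [] := pJ' x I xx0.
- move=> n x F h; have pl := plateau n x h.
  have xx0 : x != x0.
    apply/eqP => e; move: h; rewrite e mdistxx mulr0 => /andP[+ _].
    rewrite leNgt => /negP; apply; rewrite mulr_gt0// subr_gt0.
    have : 0 < a^-1 by rewrite invr_gt0.
    by rewrite /eta /annulus_gap; lra.
  have [uJ _ pin _] := pJ' x I (elimN eqP xx0).
  have nJ : n \in J x by apply: pin; rewrite pl eqxx oner_eq0.
  rewrite GE// (bigD1_seq n)//= big1 ?addr0; last first.
    by move=> m /negbTE mn; rewrite pl mn mul0r.
  by rewrite pl eqxx mul1r.
Qed.

(** Coordinate [n] is [f] rescaled by [s (- n)] and restricted to the ball. Extending and gluing
    recovers [f]: with [t0 := r / a], weight [n] is supported where [s n] maps into the ball. *)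
Lemma full_complemented_flinf_cball (r : R) : 0 < r ->
  complemented full (flinf nat (lip_space (cball r) x0)).
Proof.
move=> r0; apply: complemented_trans (complemented_flinf_inj int _).
have [E bE EE] := cball_extension r0 (@subsetT _ _).
have [G [J [psi [[bG G0] GE G1 supp _]]]] := annuli_glue (divr_gt0 r0 a0).
exists (fun f p => if `[< cball r p.2 >] then a ^ p.1 * f (s (- p.1) p.2) else
  0),
  (fun h => G (flinf_map E h)); split.
- split=> [x|]; first by finite_functional_tac.
  exists 1 => // f L [L0 fL fD f0]; rewrite mul1r; split=> // n; split=> //=.
  + move=> x y xr yr; rewrite !asboolT// -mulrBr normrM gtr0_norm//.
    apply: (le_trans (ler_wpM2l (ltW (an0 n)) (fL _ _ I I))).
    by rewrite sd mulrCA [a ^ n * (_ * _)]mulrA [a ^ n * _]mulrC aK mul1r.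
  + by move=> x xr; rewrite asboolF.
  + by rewrite asboolT ?s0 ?f0 ?mulr0//; exact: cball0.
- exact: (bounded_op_comp (bounded_op_flinf int bE) bG).
- move=> f L [L0 fL fD f0]; apply/funext => x.
  have [->|xx0] := eqVneq x x0; first by rewrite G0 f0.
  rewrite GE// -[RHS]mul1r -(G1 x xx0) mulr_suml; apply: eq_bigr => n _.
  have [->|pn] := eqVneq (psi n x) 0; first by rewrite !mul0r.
  have xr : cball r (s n x).
    rewrite /cball/= -{1}(s0 n) sd; apply/ltW.
    by have := supp n x pn; rewrite mulrCA mulfV ?gt_eqF// mulr1.
  rewrite /flinf_map/= EE// asboolT// mulrA aK mul1r; congr (_ * f _).
  by have := sK (- n) x; rewrite opprK.
Qed.

(** The product rule; the bump vanishes from distance [2 * tau] on, so a local bound on [k]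
    suffices. *)
Lemma cutoff_lipschitz (y : M) (tau L L' : R) (k : M -> R) :
  0 < tau -> 0 <= L -> 0 <= L' ->
  (forall u v, `|k u - k v| <= L * mdist u v) ->
  (forall u, mdist u y <= 2 * tau -> `|k u| <= L') ->
  forall u v, `|bump y tau u * k u - bump y tau v * k v| <=
    (L + L' / tau) * mdist u v.
Proof.
move=> tau0 L0 L'0 kL kL'.
have one u v : bump y tau u != 0 ->
    `|bump y tau u * k u - bump y tau v * k v| <= (L + L' / tau) * mdist u v.
  move=> bu; have -> : bump y tau u * k u - bump y tau v * k v =
    bump y tau v * (k u - k v) + (bump y tau u - bump y tau v) * k u by ring.
  apply: (le_trans (ler_normD _ _)); rewrite [leRHS]mulrDl; apply: lerD.
    have /andP[b0 b1] := bump01 y tau v; rewrite normrM ger0_norm//.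
    by rewrite (le_trans (ler_wpM2l b0 (kL u v)))// ler_piMl// mulr_ge0//
      mdist_ge0.
  rewrite normrM mulrC mulrAC -mulrA.
  by apply: ler_pM => //; [exact/kL'/ltW/bump_neq0|exact: bump_lip].
move=> u v; have [bu|] := eqVneq (bump y tau u) 0; last exact: one.
have [bv|bv] := eqVneq (bump y tau v) 0.
  rewrite bu bv !mul0r subrr normr0 mulr_ge0 ?mdist_ge0//.
  by rewrite addr_ge0// divr_ge0// ltW.
by rewrite distrC metric_sym; exact: one.
Qed.


Let eta_bounds : 0 < eta < 1.
Proof.
have : 0 < a^-1 < 1 by rewrite invr_gt0 a0 invf_lt1.
by rewrite /eta /annulus_gap => /andP[? ?]; apply/andP; split; lra.
Qed.

(* The copies [s (- k) (g (cball sigma))], for large [k], lie in pairwise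
   distinct annuli and carry independent functions. *)
Lemma flinf_cball_complemented (r c C : R) (y : M) (g g' : M -> M) :
  0 < r -> y != x0 -> g x0 = y -> cancel g g' -> cancel g' g ->
  0 < c -> 0 < C ->
  (forall u v, c * mdist u v <= mdist (g u) (g v) <= C * mdist u v) ->
  exists2 sigma, 0 < sigma &
    complemented (flinf nat (lip_space (cball sigma) x0))
      (lip_space (cball r) x0).
Proof.
move=> r0 yx0 gx0 gK g'K c0 C0 gL.
pose t0 := mdist y x0; have t0_gt0 : 0 < t0 by rewrite mdist_gt0.
have /andP[eta0 eta1] := eta_bounds.
(* Points within [tau] of [y] lie on the plateau, and the bump, supported within
   [2 * tau = eta * t0] of [y], vanishes at [x0]. The radius [tau / C] makes [g] map the small ball
   to where the bump is 1. *)
pose tau := eta * t0 / 2.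
have et0 : 0 < eta * t0 by exact: mulr_gt0.
have tau0 : 0 < tau by exact: divr_gt0.
have sigma0 : 0 < tau / C by exact: divr_gt0.
exists (tau / C) => //; set B := cball (tau / C).
have [E bE EE] := cball_extension sigma0 (@subsetT _ _).
have [G [J [psi [[bG G0] _ _ _ GE]]]] := annuli_glue t0_gt0.
have gB z : B z -> mdist (g z) y <= tau.
  move=> Bz; have /andP[_] := gL z x0; rewrite gx0 => h; apply: (le_trans h).
  by rewrite mulrC -ler_pdivlMr.
(* Copies are placed only at scales from [n1] on, where they lie inside [cball r]. *)
have [n1 n1P] : exists n1 : int, a ^ (- n1) * (2 * t0) <= r.
  have [n /andP[_ h]] := exprz_bracket a1 (divr_gt0 (mulr_gt0 (ltr0n R 2)
    t0_gt0) r0).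
  exists (1 - n); rewrite opprB expfzDr ?gt_eqF// exprN1.
  rewrite mulrA ltr_pdivrMr// in h.
  by rewrite mulrAC ler_pdivrMr// [r * a]mulrC ltW.
have shift_near m z : mdist z y <= tau -> mdist (s (- (Posz m + n1)) z) x0 <= r.
  move=> zy; rewrite -{1}(s0 (- (Posz m + n1))) sd; apply: le_trans n1P.
  have zx0 : mdist z x0 <= 2 * t0.
    have := metric_triangle z y x0; rewrite -/t0 => h.
    by have : eta * t0 <= t0 by [rewrite ler_piMl// ltW]; rewrite /tau in zy;
      lra.
  apply: ler_pM => //; [exact: ltW|exact: mdist_ge0|].
  by apply: ler_weXz2l; [exact: ltW|rewrite lerN2 lerDr].
(* [h] is extended to [M], transported by [g], and cut off near [y]. *)
pose H (h : M -> R) x := bump y tau x * E h (g' x).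
have bH : @bounded_op R (lip_space B x0) full H.
  have [Ef [K K0 EK]] := bE; split.
    by move=> x; apply: finite_functionalZ; exact: Ef.
  (* The bounds put into [cutoff_lipschitz] are [K * L / c] and [2 * tau] times it; together they
     give three times [K * L / c]. *)
  exists (3 * (K / c)) => [|h L hL]; first by rewrite mulr_ge0// divr_ge0// ltW.
  have [KL0 ehL _ eh0] := EK _ _ hL.
  have g'L u v : mdist (g' u) (g' v) <= mdist u v / c.
    have /andP[h1 _] := gL (g' u) (g' v).
    by rewrite !g'K in h1; rewrite ler_pdivlMr// mulrC.
  have kL u v : `|E h (g' u) - E h (g' v)| <= K * L / c * mdist u v.
    apply: (le_trans (ehL _ _ I I)); rewrite -mulrA ler_wpM2l//.
    by rewrite mulrC.
  have g'y : g' y = x0 by rewrite -gx0 gK.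
  have kL' u : mdist u y <= 2 * tau -> `|E h (g' u)| <= K * L / c * (2 * tau).
    move=> uy; have := kL u y; rewrite g'y eh0 subr0 => /le_trans; apply.
    by apply: ler_wpM2l => //; rewrite divr_ge0// ltW.
  have KLc : 0 <= K * L / c by rewrite divr_ge0// ltW.
  split=> //.
  + by rewrite mulr_ge0 ?(nle_ge0 hL)// mulr_ge0// divr_ge0// ltW.
  + move=> u v _ _; rewrite /H.
    have h2 : 0 <= K * L / c * (2 * tau) by rewrite mulr_ge0// mulr_ge0// ltW.
    apply: (le_trans (cutoff_lipschitz tau0 KLc h2 kL kL' u v)).
    rewrite le_eqVlt; apply/orP; left; apply/eqP.
    by field; rewrite !gt_eqF.
  + by move=> x [].
  + rewrite /H; have [->|] := eqVneq (bump y tau x0) 0; first by rewrite mul0r.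
    move=> /(bump_neq0 tau0); rewrite metric_sym -/t0 /tau.
    by have : eta * t0 < t0 by [rewrite gtr_pMl]; lra.
pose spread (F : nat * M -> R) (p : int * M) : R :=
  if p.1 - n1 is Posz m then F (m, p.2) else 0.
have bspread : @bounded_op R (flinf nat full) (flinf int full) spread.
  split=> [[n z]|]; rewrite /spread /=.
    by case: (n - n1) => m; finite_functional_tac.
  exists 1 => // F L [L0 FL]; rewrite mul1r; split=> // n /=.
  by case: (n - n1) => m; [exact: (FL m)|exact: (nle0 full L0)].
pose T (h : nat * M -> R) x :=
  if `[< cball r x >] then G (spread (flinf_map H h)) x else 0.
(* Subtracting the value at the copy of [y = g x0] makes each coordinate vanish at [x0]; on the
   range of [T] that value is 0. *)
pose U (f : M -> R) (p : nat * M) : R := if `[< B p.2 >] then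
  a ^ (Posz p.1 + n1) *
    (f (s (- (Posz p.1 + n1)) (g p.2)) - f (s (- (Posz p.1 + n1)) y)) else 0.
have By : mdist y y <= tau by rewrite mdistxx ltW.
exists T, U; split.
- have bGH :=
    bounded_op_comp (bounded_op_comp (bounded_op_flinf nat bH) bspread) bG.
  exact: (bounded_op_comp bGH
    (bounded_op_restriction (cball0 r0) (@subsetT _ _))).
- split=> [[m z]|]; first by rewrite /U; finite_functional_tac.
  exists C => [|f L [L0 fL fD f0]]; first exact: ltW.
  split; first by rewrite mulr_ge0// ltW.
  move=> m; rewrite /U /=; set k := Posz m + n1; split=> //.
  + by rewrite mulr_ge0// ltW.
  + move=> u v Bu Bv; rewrite !asboolT// -mulrBr normrM gtr0_norm//.
    have -> : f (s (- k) (g u)) - f (s (- k) y) -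
      (f (s (- k) (g v)) - f (s (- k) y)) = f (s (- k) (g u)) - f (s (- k) (g
        v)).
      by ring.
    have h := fL _ _ (shift_near m _ (gB u Bu)) (shift_near m _ (gB v Bv)).
    apply: (le_trans (ler_wpM2l (ltW (an0 k)) h)).
    rewrite sd mulrCA [a ^ k * (_ * _)]mulrA [a ^ k * _]mulrC aK mul1r.
    rewrite [C * L]mulrC -mulrA ler_wpM2l//.
    by have /andP[] := gL u v.
  + by move=> x Bx; rewrite asboolF.
  + by rewrite asboolT ?gx0 ?subrr ?mulr0//; exact: cball0.
- move=> h L [L0 hL]; apply/funext => -[m z]; rewrite /U /=.
  have [_ hL2 hD h0] := hL m.
  have [Bz|nBz] := pselect (B z); last by rewrite asboolF// hD.
  rewrite asboolT//; set k := Posz m + n1.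
  have TE w : B w -> T h (s (- k) (g w)) = a ^ (- k) * h (m, w).
    move=> Bw; have gw := gB w Bw.
    have sk : a ^ k * mdist (s (- k) (g w)) x0 = mdist (g w) x0.
      by rewrite -{1}(s0 (- k)) sd mulrA [a ^ k * _]mulrC aK mul1r.
    rewrite /T asboolT; last exact: shift_near.
    rewrite (GE k); last first.
      rewrite sk; have h1 := metric_triangle (g w) y x0;
        have h2 := metric_triangle y (g w) x0.
      rewrite (metric_sym y (g w)) -/t0 in h1 h2; rewrite /tau in gw.
      by apply/andP; split; lra.
    congr (_ * _); rewrite sK /spread /= /k addrK /flinf_map /H /=.
    by rewrite bump_eq1// mul1r gK EE.
  have BX : B x0 by exact: cball0.
  rewrite -gx0 !TE// h0 mulr0 subr0 mulrA [a ^ k * _]mulrC aK.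
  by rewrite mul1r.
Qed.

End annuli_operators.

(** * Doubling spaces and bi-Lipschitz images *)

(** Halving [k] times covers a ball of radius [2 * r] by [D ^ k] balls of radius [2 * r / 2 ^ k].
    Once [4 <= kappa * 2 ^ k], points at distance at least [kappa * r] cannot share one of these, so
    the list injects into their centers. *)
Lemma doubling_packing (R : realType) (M : metricType R) :
  doubling M -> packing [set: M].
Proof.
move=> [D hD].
have iter_cover k (x : M) (r : R) : 0 < r -> exists2 s : seq M,
    (size s <= D ^ k)%N & forall y, ball x r y ->
      exists2 c, c \in s & ball c (r / 2 ^+ k) y.
  elim: k x r => [|k IH] x r r0.
    by exists [:: x] => // y xy; exists x; rewrite ?mem_head// expr0 divr1.
  have [s sD sx] := hD x r r0.
  have r20 : 0 < r / 2 by rewrite divr_gt0.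
  have /choice[f fP] c : exists t : seq M, (size t <= D ^ k)%N /\
      forall y, ball c (r / 2) y ->
        exists2 c', c' \in t & ball c' (r / 2 / 2 ^+ k) y.
    by have [t ? ?] := IH c _ r20; exists t.
  exists (flatten [seq f c | c <- s]).
    rewrite expnS; apply: (@leq_trans (size s * D ^ k));
      last by rewrite leq_mul2r sD orbT.
    elim: s {sD sx} => // c s IHs; rewrite /= size_cat mulSn leq_add//.
    by have [] := fP c.
  move=> y /sx[c /= cs cy]; have [_ /(_ y cy)[c' c't c'y]] := fP c.
  exists c'; first by apply/flattenP; exists (f c) => //; exact: map_f.
  by rewrite exprS invfM mulrA.
move=> kappa k0.
pose k := Num.bound (4 / kappa).
have hk : 4 <= kappa * 2 ^+ k.
  rewrite mulrC -ler_pdivrMr//.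
  have : 4 / kappa < k%:R by apply: archi_boundP; rewrite divr_ge0// ltW.
  move/ltW/le_trans; apply.
  by rewrite -natrX ler_nat ltnW// ltn_expl.
exists (D ^ k)%N => r [//|x t] r0 _ px; set s := x :: t.
have r20 : 0 < 2 * r by exact: mulr_gt0.
have [cs csD cov] := iter_cover k x (2 * r) r20.
have sx y : y \in s -> ball x (2 * r) y.
  rewrite ballEmdist /= in_cons => /orP[/eqP ->|yt]; first by rewrite mdistxx.
  by move: px => /= /andP[/allP/(_ y yt)/andP[_ h] _]; lra.
have /choice[c cP] y : exists c, y \in s -> c \in cs /\ ball c (2 * r / 2 ^+
  k) y.
  have [ys|] := boolP (y \in s); last by exists x.
  by have [c ? ?] := cov y (sx y ys); exists c.
apply: leq_trans csD; rewrite -(size_map c); apply: uniq_leq_size.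
  rewrite uniq_pairwise pairwise_map.
  apply: (@sub_in_pairwise _ (mem s) _ _ _ s (allss s) px).
  move=> u v us vs /andP[h _] /=; apply/eqP => cuv.
  have [_] := cP u us; have [_] := cP v vs; rewrite cuv !ballEmdist /= => h1 h2.
  have h3 : 4 * r <= kappa * 2 ^+ k * r by rewrite ler_pM2r.
  have h4 := metric_triangle u (c v) v; rewrite (metric_sym u (c v)) in h4.
  have p0 : 0 < 2 ^+ k :> R by exact: exprn_gt0.
  rewrite ltr_pdivlMr// in h1; rewrite ltr_pdivlMr// in h2.
  have : kappa * r * 2 ^+ k <= mdist u v * 2 ^+ k by rewrite ler_pM2r.
  have : mdist u v * 2 ^+ k <= (mdist (c v) u + mdist (c v) v) * 2 ^+ k.
    by rewrite ler_pM2r.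
  by lra.
by move=> _ /mapP[y ys ->]; have [] := cP y ys.
Qed.

Lemma closed_dist_to (R : realType) (Z : metricType R) (A : set Z) (x : Z) :
  A !=set0 -> closed A -> ~ A x -> 0 < dist_to A x.
Proof.
move=> A0 clA nAx.
have : nbhs x (~` A) by apply: open_nbhs_nbhs; split=> //; exact: closed_openC.
move=> /nbhs_ballP[e /= e0 eA]; apply: (lt_le_trans e0).
apply: dist_to_ge => // a Aa; rewrite leNgt; apply/negP => xa.
by apply: (eA a) => //; rewrite ballEmdist.
Qed.

Section embeddings.
Context (R : realType) (Z M : metricType R).

Definition bilipschitz_on (D : set Z) (phi : Z -> M) : Prop :=
  exists c C : R, [/\ 0 < c, 0 < C & forall x y, D x -> D y ->
    c * mdist x y <= mdist (phi x) (phi y) <= C * mdist x y].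

(** Passes from a subtype to all of [Z], with arbitrary values off [D], so that unions can be formed
    inside one space. *)
Lemma bilipschitz_extend (D : set Z) (phi : set_type D -> M) (m0 : M) :
  bilipschitz phi -> exists psi : Z -> M,
    bilipschitz_on D psi /\ forall x, psi (set_val x) = phi x.
Proof.
move=> [c [C [c0 C0 h]]].
have /choice[psi psiP] (z : Z) : exists m, forall x : set_type D,
    set_val x = z -> m = phi x.
  have [Dz|nDz] := pselect (D z).
    exists (phi (SigSub (mem_set Dz))) => x xz; congr phi; apply/val_inj.
    exact: esym.
  by exists m0 => x xz; case: nDz; rewrite -xz; exact/set_mem/(valP x).
have E x : psi (set_val x) = phi x by exact: psiP.
exists psi; split=> //; exists c, C; split=> // x y Dx Dy.
by have := h (SigSub (mem_set Dx)) (SigSub (mem_set Dy)); rewrite -!E.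
Qed.

Lemma bilipschitz_on_inverse (D : set Z) (phi : Z -> M) (b : Z) :
  bilipschitz_on D phi -> exists psi : M -> Z, forall x, D x -> psi (phi x) = x.
Proof.
move=> [c [C [c0 C0 h]]].
have /choice[psi psiP] (m : M) : exists z, forall x, D x -> phi x = m -> z = x.
  have [[x Dx xm]|no] := pselect (exists2 x, D x & phi x = m); last first.
    by exists b => x Dx xm; case: no; exists x.
  exists x => y Dy ym; have /andP[+ _] := h x y Dx Dy.
  rewrite xm ym mdistxx pmulr_rle0// => xy.
  by apply: mdist_positivity; apply/eqP; rewrite eq_le xy mdist_ge0.
by exists psi => x Dx; exact: psiP.
Qed.

Lemma bilipschitz_on_packing (D : set Z) (phi : Z -> M) :
  bilipschitz_on D phi -> packing [set: M] -> packing D.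
Proof. by move=> [c [C [c0 C0 h]]]; exact: (packing_bilip c0 C0 _ h). Qed.

(** If the distance were 0, the points of [D] mapped ever closer to [y] would form a Cauchy filter
    by the lower bound [c]; its limit lies in the closed set [D] and is mapped to [y] by the upper
    bound [C]. *)
Lemma bilipschitz_on_closed_image (D : set Z) (phi : Z -> M) (y : M) :
  complete_metric Z -> closed D -> bilipschitz_on D phi -> D !=set0 ->
  ~ (phi @` D) y -> 0 < dist_to (phi @` D) y.
Proof.
move=> cZ clD [c [C [c0 C0 h]]] [b Db] ny; rewrite ltNge; apply/negP => dy.
have E0 : phi @` D !=set0 by exists (phi b), b.
have approx e : 0 < e -> exists2 z, D z & mdist y (phi z) < e.
  move=> e0; apply: contrapT => no.
  have : e <= dist_to (phi @` D) y.
    apply: dist_to_ge => // _ [z Dz <-]; rewrite leNgt; apply/negP => lt.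
    by apply: no; exists z.
  by move/le_trans/(_ dy); rewrite leNgt e0.
pose B (e : R) : set Z := [set z | D z /\ mdist y (phi z) < e].
pose F := filter_from [set e : R | 0 < e] B.
have FF : ProperFilter F.
  apply: filter_from_proper => [|e /approx[z Dz zy]]; last by exists z.
  apply: filter_from_filter => [|e1 e2 /= h1 h2]; first by exists 1 => /=.
  exists (Num.min e1 e2); first by rewrite /= lt_min h1.
  by move=> z [Dz]; rewrite lt_min => /andP[].
have cF : cauchy F.
  apply: cauchy_exP => _ /posnumP[e]; pose e' := c * e%:num / 2.
  have e'0 : 0 < e' by rewrite divr_gt0// mulr_gt0.
  have [z Dz zy] := approx e' e'0; exists z, e' => // w [Dw wy].
  rewrite ballEmdist /= -(ltr_pM2l c0); have /andP[+ _] := h z w Dz Dw.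
  move/le_lt_trans; apply.
  have := metric_triangle (phi z) y (phi w); rewrite (metric_sym (phi z) y).
  by rewrite /e' in zy wy; lra.
have [z Fz] := cZ F FF cF.
have near e : 0 < e -> exists w, [/\ D w, mdist y (phi w) < e & mdist z w < e].
  move=> e0; have [e1 /= e10 e1B] := Fz _ (nbhsx_ballx z e e0).
  have [|w Dw wy] := approx (Num.min e e1); first by rewrite lt_min e0.
  move: wy; rewrite lt_min => /andP[we we1]; exists w; split=> //.
  by have := e1B w (conj Dw we1); rewrite ballEmdist.
have Dz : D z.
  apply: clD => N /nbhs_ballP[e /= e0 eN].
  have [w [Dw _ zw]] := near e e0; exists w; split=> //.
  by apply: eN; rewrite ballEmdist.
apply: ny; exists z => //; apply/esym/mdist_positivity/eqP.
rewrite eq_le mdist_ge0 andbT; apply/ler_addgt0Pl => e e0; rewrite addr0.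
have e'0 : 0 < e / (1 + C) by rewrite divr_gt0// addr_gt0.
have [w [Dw wy zw]] := near _ e'0.
apply: (le_trans (metric_triangle y (phi w) (phi z))).
have /andP[_ hC] := h w z Dw Dz; rewrite (metric_sym w) in hC.
apply: (le_trans (lerD (ltW wy) (le_trans hC (ler_wpM2l (ltW C0) (ltW zw))))).
have -> : e / (1 + C) + C * (e / (1 + C)) = e; last by [].
by field; rewrite gt_eqF// addr_gt0.
Qed.

End embeddings.

(** * Adjoints between free spaces *)

Section free_space_adjoint.
Context (R : realType).

Lemma linear_span_seq (V : normedModType R) (S : set V) (l : seq (R * V)) :
  (forall q, q \in l -> S q.2) -> linear_span S (\sum_(q <- l) q.1 *: q.2).
Proof.
move=> lS; exists (size l), (fun i => (tnth (in_tuple l) i).1),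
  (fun i => (tnth (in_tuple l) i).2); split; last by rewrite big_tnth.
by move=> i; apply/lS/mem_tnth.
Qed.

Lemma dual_sumE (V : normedModType R) (I : Type) (r : seq I) (F : I -> dual V)
  (v : V) : (\sum_(i <- r) F i) v = \sum_(i <- r) F i v.
Proof. by elim: r => [|i r IH]; rewrite ?big_nil// !big_cons -IH. Qed.

Lemma linear_bounded_continuous (V W : normedModType R) (f : {linear V -> W})
  (C : R) : (forall v, `|f v| <= C * `|v|) -> continuous f.
Proof.
move=> fC; apply: bounded_linear_continuous.
apply/linear_boundedP; exists C; split; first exact: num_real.
by move=> r /ltW Cr v; rewrite (le_trans (fC v))// ler_wpM2r.
Qed.

Context (X Y : metricType R) (x0 : X) (y0 : Y).
Variable P : (Y -> R) -> X -> R.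
Hypothesis bP :
  @bounded_op R (lip_space [set: Y] y0) (lip_space [set: X] x0) P.

Lemma lip0_nle (T : metricType R) (t0 : T) (f : lip0 t0) :
  @nle R (lip_space [set: T] t0) f (lip_norm f).
Proof.
have /asboolP[_ f0] := lip0P f.
split=> //; [exact: lip_norm_ge0| |by move=> x []].
by move=> x y _ _; exact: lip_normP.
Qed.

Let lift_in (g : lip0 y0) : P g \in @lip0_pred R X x0.
Proof.
have [_ [C _ hC]] := bP; have [_ gL _ g0] := hC _ _ (lip0_nle g).
apply/asboolP; split=> //; exists (C * lip_norm g) => u v.
exact: (gL u v I I).
Qed.

Definition lip0_lift (g : lip0 y0) : lip0 x0 := Lip0 (lift_in g).

Let lift_linear : linear lip0_lift.
Proof.
move=> a f g; apply/val_inj/funext => x /=; have [Pf _] := bP.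
exact: (finite_functional_lin a f g (Pf x)).
Qed.

HB.instance Definition _ :=
  GRing.isLinear.Build R (lip0 y0) (lip0 x0) *:%R lip0_lift lift_linear.

Lemma lip0_lift_bound : exists2 C, 0 <= C & forall g, `|lip0_lift g| <= C *
  `|g|.
Proof.
have [_ [C C0 hC]] := bP; exists C => // g.
have [L0 gL _ _] := hC _ _ (lip0_nle g).
by apply: lip_norm_le => // u v; exact: (gL u v I I).
Qed.

Let adjoint_in (m : dual (lip0 x0)) :
  (m \o lip0_lift : lip0 y0 -> R^o) \in @dual_pred R (lip0 y0).
Proof.
apply/asboolP; split=> [a f g|]; first by rewrite /= !linearP.
have [C C0 hC] := lip0_lift_bound.
apply: (@linear_bounded_continuous _ _ (m \o lip0_lift) (dual_norm m * C)) => v.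
rewrite /= (le_trans (dual_normP _ _))// -mulrA ler_wpM2l//.
exact: dual_norm_ge0.
Qed.

Definition adjoint (m : dual (lip0 x0)) : dual (lip0 y0) := Dual (adjoint_in m).

Let adjoint_linear : linear adjoint.
Proof. by move=> a f g; apply/val_inj/funext. Qed.

HB.instance Definition _ := GRing.isLinear.Build R (dual (lip0 x0))
  (dual (lip0 y0)) *:%R adjoint adjoint_linear.

Lemma adjoint_bound :
  exists2 C, 0 <= C & forall m, `|adjoint m| <= C * `|m|.
Proof.
have [C C0 hC] := lip0_lift_bound; exists C => // m.
apply: dual_norm_le => [|v]; first by rewrite mulr_ge0.
rewrite /= (le_trans (dual_normP _ _))// -[`|m|]/(dual_norm m).
by rewrite [C * _]mulrC -mulrA ler_wpM2l// dual_norm_ge0.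
Qed.

(** The adjoint sends [delta x0 x] to [g |-> P g x], which row-finiteness makes a finite combination
    of evaluations at points of [Y]. *)
Lemma adjoint_span (m : dual (lip0 x0)) :
  linear_span (range (delta x0)) m -> linear_span (range (delta y0)) (adjoint
    m).
Proof.
move=> [n [a [s [sS ->]]]]; have [Pf _] := bP.
have /choice[x xP] i : exists x, s i = delta x0 x.
  by have [x _ <-] := sS i; exists x.
have [l lP] := finite_functional_sum (index_enum 'I_n)
  (fun i => finite_functionalZ (a i) (Pf (x i))).
have -> : adjoint (\sum_(i < n) a i *: s i) =
    \sum_(q <- [seq (q.1, delta y0 q.2) | q <- l]) q.1 *: q.2.
  apply/val_inj/funext => g /=; rewrite !dual_sumE big_map -lP.
  by apply: eq_bigr => i _; rewrite xP.
by apply: linear_span_seq => _ /mapP[q _ ->] /=; exists q.2.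
Qed.

Lemma adjoint_closed_span (m : free_space x0) :
  adjoint (closed_span_val m) \in closed_span_pred (range (delta y0)).
Proof.
apply/asboolP => B nB; have /asboolP cm := closed_spanP m.
have [C C0 hC] := adjoint_bound.
have /(_ _ nB) := @linear_bounded_continuous _ _ adjoint C hC (closed_span_val
  m).
move=> /cm[p [Sp Bp]]; exists (adjoint p); split=> //.
exact: adjoint_span.
Qed.

Definition free_adjoint (m : free_space x0) : free_space y0 :=
  ClosedSpan (adjoint_closed_span m).

Let free_adjoint_linear : linear free_adjoint.
Proof. by move=> a f g; apply/val_inj; rewrite /= linearP. Qed.

HB.instance Definition _ := GRing.isLinear.Build R (free_space x0)
  (free_space y0) *:%R free_adjoint free_adjoint_linear.

Lemma free_adjoint_op : exists S : {linear free_space x0 -> free_space y0},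
  continuous S /\ forall m g,
    closed_span_val (S m) g = closed_span_val m (lip0_lift g).
Proof.
exists free_adjoint; split=> //; have [C C0 hC] := adjoint_bound.
by apply: (@linear_bounded_continuous _ _ free_adjoint C) => m; exact: hC.
Qed.

End free_space_adjoint.

(** Adjoints reverse direction: the one of [U] goes from the free space of [X] to that of [Y], the
    one of [T] back. *)
Lemma isomorphic_free_space (R : realType) (X Y : metricType R) (x0 : X)
  (y0 : Y) : fiso (lip_space [set: X] x0) (lip_space [set: Y] y0) ->
  isomorphic (free_space x0) (free_space y0).
Proof.
move=> [T [U [bT bU UT TU]]].
have [S [cS SE]] := free_adjoint_op bU;
  have [S' [cS' S'E]] := free_adjoint_op bT.
exists S, S'; split=> // m; apply/val_inj/val_inj/funext => g /=.
  rewrite S'E SE; congr (closed_span_val m _); apply/val_inj => /=.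
  exact: UT (lip0_nle g).
rewrite SE S'E; congr (closed_span_val m _); apply/val_inj => /=.
exact: TU (lip0_nle g).
Qed.

(** * Comparison with the reference space *)

Section reference_space.
Context (R : realType) (Z M : metricType R) (x0 : M).
Hypothesis ssM : self_similar x0.
Hypothesis bhM : bilipschitz_homogeneous M.
Hypothesis ntM : exists y : M, y != x0.
Hypothesis pM : packing [set: M].

Let Y := flinf nat (lip_space [set: M] x0).

Lemma full_complemented : complemented (lip_space [set: M] x0) Y.
Proof.
apply: complemented_trans (complemented_fsuml _ Y) _.
exact/fiso_complemented/fiso_sym/fiso_flinfS.
Qed.

(** For a small ball [B], [Y] is complemented in [flinf nat (flinf nat (lip_space B x0))], which
    collapses to [flinf nat (lip_space B x0)], and this is complemented in the functions on the
    given ball. *)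
Lemma reference_complemented_ball (r : R) : 0 < r ->
  complemented Y (lip_space [set x | mdist x x0 <= r] x0).
Proof.
move=> r0; have [a [s [a1 sd sK s0]]] := self_similar_scaling ssM.
have [y yx0] := ntM; have [g [[g' gK g'K] [c [C [c0 C0 gL]]] gx0]] := bhM x0 y.
have [sigma sigma0 cs] :=
  flinf_cball_complemented a1 sd sK s0 pM r0 yx0 gx0 gK g'K c0 C0 gL.
apply: complemented_trans cs.
apply: complemented_trans (fiso_complemented (fiso_flinf_flinf _)).
apply: complemented_flinf.
exact: (full_complemented_flinf_cball a1 sd sK s0 pM sigma0).
Qed.

Lemma fiso_full_reference : fiso (lip_space [set: M] x0) Y.
Proof.
apply: fiso_of_complemented; first exact: full_complemented.
apply: complemented_trans (reference_complemented_ball ltr01) _.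
have b0 : mdist x0 x0 <= 1 by rewrite mdistxx.
apply: lip_space_complemented => // x _ /negP; rewrite -ltNge => x1.
apply: (@lt_le_trans _ _ (mdist x x0 - 1)); first by rewrite subr_gt0.
apply: dist_to_ge; first by exists x0.
by move=> z /= z1; rewrite lerBlDr (le_trans (metric_triangle x z x0))// lerD2l.
Qed.

(** Closedness and packing are carried along because the step to a union uses them. For empty [V]
    the last clause is vacuous. *)
Definition reference_dominated (V : set Z) : Prop :=
  [/\ closed V, packing V &
      forall b, V b -> complemented (lip_space V b) Y].

Lemma scalars_reference : complemented (flinf nat (scalars R)) Y.
Proof.
have [y yx0] := ntM; apply: complemented_flinf.
exact: (scalars_complemented _ _ yx0).
Qed.

Lemma reference_dominated0 : reference_dominated set0.
Proof. by split=> //; [exact: closed0|exact: packing_set0]. Qed.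

(** The Whitney decomposition splits the union into [V], [W] and scalars; each summand is
    complemented in [Y], and two uses of [Y + Y ~ Y] absorb the sum. *)
Lemma reference_dominated_union V W : reference_dominated V ->
  reference_dominated W -> reference_dominated (V `|` W).
Proof.
move=> [clV pV cV] [clW pW cW]; split; [exact: closedU|exact: packing_union|].
have [->|/set0P[v Vv]] := eqVneq V set0; first by rewrite set0U.
have [->|/set0P[w Ww]] := eqVneq W set0; first by rewrite setU0.
move=> b VWb.
have VWv : (V `|` W) v by left.
apply: complemented_trans (fiso_complemented (lip_space_base VWb VWv)) _.
apply: complemented_trans (lip_space_union Vv Ww _ (packing_union pV pW)) _.
  by move=> x _; apply: closed_dist_to => //; exists v.
have YY := fiso_sym (fiso_flinf_double (lip_space [set: M] x0)).
apply: complemented_trans (fiso_complemented YY).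
apply: complemented_fsum; first exact: cV.
apply: complemented_trans (fiso_complemented YY).
by apply: complemented_fsum; [exact: cW|exact: scalars_reference].
Qed.

(** Up to isomorphism [V] is its image in [M], which is closed because [V] is complete; hence its
    functions are complemented in those on [M]. *)
Lemma reference_dominated_embedded (V : set Z) (phi : Z -> M) :
  complete_metric Z -> closed V -> bilipschitz_on V phi ->
  reference_dominated V.
Proof.
move=> cZ clV bphi; split=> //; first exact: bilipschitz_on_packing bphi pM.
move=> b Vb; have [psi psiK] := bilipschitz_on_inverse b bphi.
have [c [C [c0 C0 h]]] := bphi.
have Eb : (phi @` V) (phi b) by exists b.
have iso : fiso (lip_space V b) (lip_space (phi @` V) (phi b)).
  apply: (@lip_space_bilip _ _ _ V _ b phi psi (C + c^-1)) => //.
  - by rewrite addr_ge0 ?invr_ge0 ?ltW.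
  - by move=> _ [x Vx <-]; rewrite psiK.
  - by move=> _ [x Vx <-]; rewrite psiK.
  - move=> x y Vx Vy; have /andP[_ hC] := h x y Vx Vy; apply: (le_trans hC).
    by rewrite ler_wpM2r ?mdist_ge0// lerDl invr_ge0 ltW.
  - move=> _ _ [x Vx <-] [y Vy <-]; rewrite !psiK//.
    have /andP[hc _] := h x y Vx Vy.
    rewrite mulrDl; apply: ler_wpDl; first by rewrite mulr_ge0 ?mdist_ge0 ?ltW.
    by rewrite mulrC ler_pdivlMr// mulrC.
apply: complemented_trans (fiso_complemented iso) _.
apply: complemented_trans full_complemented.
apply: complemented_trans (fiso_complemented
  (@lip_space_base _ _ setT (phi b) x0 I I)).
apply: lip_space_complemented => // y _ ny.
by apply: bilipschitz_on_closed_image ny => //; exists b.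
Qed.

(** Homogeneity moves a ball at [x0] to the interior point [p], and [phi] pulls it back to a subset
    [D'] of [D]. The functions on [D'] contain a complemented copy of [Y] and are complemented in
    those on [V]. *)
Lemma fiso_reference (V D : set Z) (phi : Z -> M) (b : Z) :
  reference_dominated V -> V b -> closed D -> D `<=` V -> bilipschitz_on D phi
    ->
  interior (phi @` D) !=set0 -> fiso (lip_space V b) Y.
Proof.
move=> [clV pV cV] Vb clD DV bphi [p /nbhs_ballP[r /= r0 rD]].
apply: fiso_of_complemented; first exact: cV.
have [psi psiK] := bilipschitz_on_inverse b bphi.
have [c [C [c0 C0 phiL]]] := bphi.
have [g [[g' gK g'K] [c' [C' [c'0 C'0 gL]]] gx0]] := bhM x0 p.
(* [g] maps the ball of radius [t] to within [C' * t = r / 2] of [p], inside the image of [D]. *)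
pose t := r / (2 * C'); have t0 : 0 < t by rewrite divr_gt0// mulr_gt0.
pose B := [set x | mdist x x0 <= t].
have Bx0 : B x0 by rewrite /B/= mdistxx ltW.
have gD x : B x -> exists2 z, D z & phi z = g x.
  move=> Bx; apply: rD; rewrite ballEmdist /= metric_sym -gx0.
  have /andP[_ h] := gL x x0; apply: (le_lt_trans h).
  apply: (@le_lt_trans _ _ (C' * t)); first by rewrite ler_wpM2l// ltW.
  have -> : C' * t = r / 2 by rewrite /t; field; rewrite gt_eqF.
  by rewrite gtr_pMr// invf_lt1// ltr1n.
(* This is the image of [B] under [psi \o g], in a form suited to estimating distances from it. *)
pose D' : set Z := [set z | D z /\ B (g' (phi z))].
have D'V : D' `<=` V by move=> z [Dz _]; exact: DV.
have jD x : B x -> D' (psi (g x)).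
  by move=> Bx; have [z Dz zx] := gD x Bx; rewrite -zx psiK//; split=> //;
    rewrite zx gK.
have phij x : B x -> phi (psi (g x)) = g x.
  by move=> Bx; have [z Dz zx] := gD x Bx; rewrite -zx psiK.
have g'L u v : mdist (g' u) (g' v) <= mdist u v / c'.
  have /andP[h1 _] := gL (g' u) (g' v).
  by rewrite !g'K in h1; rewrite ler_pdivlMr// mulrC.
have g'phiL u v : D u -> D v ->
    mdist (g' (phi u)) (g' (phi v)) <= C / c' * mdist u v.
  move=> Du Dv; have /andP[_ h] := phiL u v Du Dv; apply: (le_trans (g'L _ _)).
  by rewrite mulrAC ler_pM2r ?invr_gt0.
have jL x y : B x -> B y -> mdist (psi (g x)) (psi (g y)) <= C' / c * mdist x y.
  move=> Bx By; have [[Du _] [Dv _]] := (jD x Bx, jD y By).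
  have /andP[h _] := phiL _ _ Du Dv; rewrite !phij// in h.
  have /andP[_ h'] := gL x y.
  by rewrite mulrAC ler_pdivlMr// mulrC (le_trans h).
have Cc0 : 0 < C / c' by exact: divr_gt0.
have Cc'0 : 0 < C' / c by exact: divr_gt0.
apply: complemented_trans (reference_complemented_ball t0) _.
pose j0 := psi (g x0).
have D'j0 : D' j0 := jD x0 Bx0.
have iso : fiso (lip_space B x0) (lip_space D' j0).
  apply: (@lip_space_bilip _ _ _ B D' x0 (psi \o g) (g' \o phi)
    (C / c' + C' / c)) => //.
  - by rewrite addr_ge0// ltW.
  - by move=> y [].
  - by move=> x Bx /=; rewrite phij// gK.
  - by move=> z [Dz _] /=; rewrite g'K psiK.
  - move=> x y Bx By; apply: (le_trans (jL x y Bx By)).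
    by rewrite ler_wpM2r ?mdist_ge0// lerDr ltW.
  - move=> u v [Du _] [Dv _]; apply: (le_trans (g'phiL u v Du Dv)).
    by rewrite ler_wpM2r ?mdist_ge0// lerDl ltW.
apply: complemented_trans (fiso_complemented iso) _.
apply: complemented_trans (fiso_complemented (lip_space_base (D'V _ D'j0) Vb)).
apply: lip_space_complemented => // z Vz nD'z.
have D'0 : D' !=set0 by exists j0.
(* Off [D] the distance to [D'] is positive since [D] is closed; inside [D], the Lipschitz map
   [g' \o phi] sends [z] out of the closed ball by a positive margin. *)
have [Dz|nDz] := pselect (D z); last first.
  apply: (@lt_le_trans _ _ (dist_to D z)).
    by apply: closed_dist_to => //; exists j0; case: D'j0.
  by apply: dist_to_ge => // w [Dw _]; apply: dist_to_le => //; exists w.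
have Bz : t < mdist (g' (phi z)) x0.
  by rewrite ltNge; apply/negP => Bz; apply: nD'z.
apply: (@lt_le_trans _ _ ((mdist (g' (phi z)) x0 - t) / (C / c'))).
  by rewrite divr_gt0// subr_gt0.
apply: dist_to_ge => // w [Dw Bw]; rewrite ler_pdivrMr//.
rewrite [mdist z w * _]mulrC; apply: le_trans (g'phiL z w Dz Dw).
by rewrite lerBlDr (le_trans (metric_triangle _ (g' (phi w)) _))// lerD2l.
Qed.

End reference_space.

Lemma fiso_set_type (R : realType) (Z : metricType R) (D : set Z)
  (b : set_type D) :
  fiso (lip_space [set: set_type D] b) (lip_space D (set_val b)).
Proof.
pose psi (z : Z) : set_type D := insubd b z.
have psiK z : D z -> set_val (psi z) = z.
  by move=> Dz; exact: (insubdK b (mem_set Dz)).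
apply: (@lip_space_bilip _ _ _ setT D b set_val psi 1) => //.
- by move=> x _; exact/set_mem/(valP x).
- move=> x _; apply/val_inj; apply: psiK; exact/set_mem/(valP x).
- by move=> x y _ _; rewrite mul1r.
- move=> x y Dx Dy; rewrite mul1r -[mdist (psi x) _]/(mdist (set_val _)
  (set_val _)).
  by rewrite !psiK.
Qed.

(* [ntM]: the one-point space satisfies the other hypotheses on [M], but with
   [Z] a finite metric space and each [X i] a single point, [free_space z0] can
   have any dimension up to [k], whereas [free_space x0] is zero. *)
Theorem corollary3p9 (R : realType) (Z M : metricType R) (x0 : M)
  (cZ : complete_metric Z)
  (ssM : self_similar x0)
  (dM : doubling M)
  (bhM : bilipschitz_homogeneous M)
  (ntM : exists y : M, y != x0)
  (k : nat) (X : 'I_k.+1 -> set Z)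
  (clX : forall i, closed (X i))
  (phi : forall i, set_type (X i) -> M)
  (bphi : forall i, bilipschitz (phi i))
  (iphi : interior (range (phi ord0)) !=set0)
  (z0 : set_type (\bigcup_i X i)) :
  isomorphic (free_space z0) (free_space x0).
Proof.
have pM := doubling_packing dM.
apply: isomorphic_free_space.
apply: (fiso_trans (fiso_set_type z0)).
apply: fiso_trans (fiso_sym (fiso_full_reference ssM bhM ntM pM)).
have domX i : reference_dominated x0 (X i).
  have [psi [bpsi _]] := bilipschitz_extend x0 (bphi i).
  by apply: reference_dominated_embedded bpsi.
have domU : reference_dominated x0 (\bigcup_i X i).
  have -> : \bigcup_i X i = \big[setU/set0]_(i < k.+1) X i.
    rewrite -(bigcup_seq (index_enum _)); apply/seteqP.
    by split=> z [i _ Xz]; exists i => //=; exact: mem_index_enum.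
  apply: (big_ind (@reference_dominated R Z M x0)) => //.
    exact: reference_dominated0.
  by move=> V W; exact: reference_dominated_union.
have [psi [bpsi psiE]] := bilipschitz_extend x0 (bphi ord0).
apply: (fiso_reference ssM bhM ntM pM domU _ (clX ord0) _ bpsi).
- exact/set_mem/(valP z0).
- exact: bigcup_sup.
- move: iphi; congr (interior _ !=set0); apply/seteqP; split=> y.
    by move=> [x _ <-]; exists (set_val x); rewrite ?psiE//;
      exact/set_mem/(valP x).
  by move=> [z Dz <-]; exists (SigSub (mem_set Dz)); rewrite // -psiE.
Qed.
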